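(* Let $1<r<\infty$ and $1\le s\le\infty$. Then there exists a constant $C=C(r,s)>0$ such that for every sequence $(J_m)_{m\ge1}$ of tetrahedral index sets, each $J_m$ of degree at most $m$, and every $n$, $$\boldsymbol{\chi_{\mathrm{mon}}}\big(\mathcal{P}_{J_m}(\ell_{r,s}^n)\big)\le C^m\Big(\frac{n}{m}\Big)^{(m-1)\min\{\frac12,\frac1{r'}\}}\quad\text{and}\quad \boldsymbol{\lambda}\big(\mathcal{P}_{J_m}(\ell_{r,s}^n)\big)\le C^m\Big(\frac{n}{m}\Big)^{m\min\{\frac12,\frac1{r'}\}}.$$
   Context: $r'$ is the conjugate exponent, $1/r+1/r'=1$. A multi-index $\alpha\in\mathbb{N}_0^n$ is tetrahedral if all entries are $0$ or $1$; an index set $J\subset\mathbb{N}_0^n$ is tetrahedral if all its elements are, and has degree at most $m$ if $|\alpha|=\sum\alpha_i\le m$ for all $\alpha\in J$. $\ell_{r,s}^n$ is $\mathbb{C}^n$ with the Lorentz (quasi-)norm $\|z\|_{\ell_{r,s}}=\|(z_k^*k^{1/r-1/s})_k\|_{\ell_s}$, $z^*$ the decreasing rearrangement of $(|z_k|)$. For a finite index set $J\subset\mathbb{N}_0^n$ and $X_n=(\mathbb{C}^n,\|\cdot\|)$, $\mathcal{P}_J(X_n)$ is the space of polynomials $P(z)=\sum_{\alpha\in J}c_\alpha z^\alpha$ with norm $\sup_{z\in B_{X_n}}|P(z)|$ ($B_{X_n}$ the open unit ball). $\boldsymbol{\lambda}(E)$ is the projection constant of the finite-dimensional space $E$: the supremum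 over all Banach spaces $Y$ and isometric embeddings $I:E\to Y$ of the infimum of $\|Q\|$ over projections $Q$ of $Y$ onto $I(E)$. $\boldsymbol{\chi_{\mathrm{mon}}}(\mathcal{P}_J(X_n))$ is the unconditional basis constant of the monomials $(z^\alpha)_{\alpha\in J}$: the least $K$ with $\|\sum\varepsilon_\alpha c_\alpha z^\alpha\|\le K\|\sum c_\alpha z^\alpha\|$ for all scalars $c_\alpha$ and all $|\varepsilon_\alpha|=1$.
   Formalization: The bounds are stated for 1 ≤ m ≤ n rather than for every n; without m ≤ n they fail, e.g. n = 1 and J_m = {0, e_1}, where both constants are at least 1 while the right-hand sides tend to 0 as m grows. *)

(* Defs.v *)
From HB Require Import structures.
From mathcomp Require Import all_boot all_order all_algebra.
From mathcomp Require Import finmap.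
From mathcomp Require Import all_classical all_reals all_analysis.
From mathcomp Require Import complex.

Set Implicit Arguments.
Unset Strict Implicit.
Unset Printing Implicit Defensive.

Import Order.TTheory GRing.Theory Num.Theory.
Import numFieldNormedType.Exports.
Local Open Scope classical_set_scope.
Local Open Scope ring_scope.

Section Defs.
Variable R : realType.
Local Notation C := R[i].

Definition cabs (z : C) : R := ComplexField.Normc.normc z.

Definition decr_rearr (n : nat) (z : 'I_n -> C) : seq R :=
  sort (fun x y : R => y <= x) [seq cabs (z i) | i <- enum 'I_n].

Definition zstar (n : nat) (z : 'I_n -> C) (k : nat) : R :=
  nth 0 (decr_rearr z) k.-1.

Definition lorentz_norm (r : R) (s : \bar R) (n : nat) (z : 'I_n -> C) : R :=
  match s with
  | EFin s' =>
      (\sum_(1 <= k < n.+1)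
          (zstar z k * (k%:R `^ (r^-1 - s'^-1))) `^ s') `^ (s'^-1)
  | _ => \big[Order.max/0]_(1 <= k < n.+1) (zstar z k * (k%:R `^ (r^-1)))
  end.

Definition multi_index (n : nat) := n.-tuple nat.

Definition mon (n : nat) (alpha : multi_index n) (z : 'I_n -> C) : C :=
  \prod_(i < n) z i ^+ tnth alpha i.

Definition tetrahedral_mi (n : nat) (alpha : multi_index n) : bool :=
  all (fun k => k <= 1)%N alpha.

Definition tetrahedral (n : nat) (J : {fset multi_index n}) : Prop :=
  forall alpha, alpha \in J -> tetrahedral_mi alpha.

Definition deg_at_most (n : nat) (J : {fset multi_index n}) (m : nat) : Prop :=
  forall alpha : multi_index n, alpha \in J -> (\sum_(i < n) tnth alpha i <= m)%N.

Definition poly_eval (n : nat) (J : {fset multi_index n}) (c : J -> C)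
  (z : 'I_n -> C) : C :=
  \sum_(a : J) c a * mon (fsval a) z.

Definition poly_norm (nrm : forall n : nat, ('I_n -> C) -> R) (n : nat)
  (J : {fset multi_index n}) (c : J -> C) : \bar R :=
  ereal_sup [set (cabs (poly_eval c z))%:E | z in [set z | nrm n z < 1]].

Definition chi_mon (nrm : forall n : nat, ('I_n -> C) -> R) (n : nat)
  (J : {fset multi_index n}) : \bar R :=
  ereal_inf [set K%:E | K in [set K : R | 0 <= K /\
     forall (c eps : J -> C), (forall a, cabs (eps a) = 1) ->
       (poly_norm nrm (fun a => (eps a * c a)%R) <= K%:E * poly_norm nrm c)%E]].

Definition op_norm (Y : normedModType C) (Q : Y -> Y) : \bar R :=
  ereal_sup [set (cabs `|Q y|)%:E | y in [set y : Y | `|y| <= 1]].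

(* projection constant of P_J(X_n).  The space P_J(X_n) is identified with
   its coefficient space (J -> C) normed by poly_norm; a linear map
   I : P_J(X_n) -> Y is determined by the images y_a of the monomials:
   I c = \sum_a c_a *: y_a. *)
Definition emb (n : nat) (J : {fset multi_index n}) (Y : normedModType C)
  (y : J -> Y) (c : J -> C) : Y := \sum_(a : J) c a *: y a.

Definition proj_const (nrm : forall n : nat, ('I_n -> C) -> R) (n : nat)
  (J : {fset multi_index n}) : \bar R :=
  ereal_sup [set v | exists (Y : completeNormedModType C) (y : J -> Y),
    (forall c, (cabs `|emb y c|)%:E = poly_norm nrm c) /\
    v = ereal_inf [set op_norm Q | Q in [set Q : {linear Y -> Y} |
          (forall x, exists c, Q x = emb y c) /\
          (forall c, Q (emb y c) = emb y c)]]].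

End Defs.

(* Main.v *)
Require Import Defs.
From HB Require Import structures.
From mathcomp Require Import all_boot all_order all_algebra.
From mathcomp Require Import finmap.
From mathcomp Require Import all_classical all_reals all_analysis.
From mathcomp Require Import complex.
From mathcomp Require Import ring lra zify.

(** Let x be a vector with entries of modulus d * j^(-1/r) on at most j
    coordinates and 0 elsewhere.  For d = d(r,s) small, x + d * z stays in the
    unit ball of l_(r,s) whenever z is in it.  The nodes are such flat vectors
    with all choices of signs: supported on the sets of at most m coordinates
    when r <= 2, on all n coordinates when r > 2.  Orthogonality of the Walsh
    functions recovers the coefficients of a tetrahedral polynomial from its
    values at the nodes.  The sum of the moduli of the terms is then bounded by
    a weighted sum of values at the nodes; for r > 2 this goes through
    Cauchy-Schwarz and Bonami's comparison of the L^2 and L^1 norms.  The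
    weights are sums of products over sets of bounded cardinality, which
    Rankin's trick bounds by C^m (n/m)^(m min(1/2,1/r')).

    For the projection constant, the point evaluations at the nodes are
    extended by Hahn-Banach.  For chi_mon, the polynomial is replaced by its
    partial derivatives, of degree m - 1, because at a flat node y the
    one-variable Cauchy estimate along y + t * u gives
    sum_j |z_j| |d_j P(y)| <= sup |P| / d. *)

Import Order.TTheory GRing.Theory Num.Theory.
Local Open Scope ring_scope.
Set Implicit Arguments.
Unset Strict Implicit.
Unset Printing Implicit Defensive.
Local Open Scope classical_set_scope.
Local Open Scope complex_scope.

(** * Real-valued modulus of complex numbers *)

Section ComplexModulus.
Variable R : realType.
Local Notation C := R[i].
Implicit Types (z w : C).

Lemma normr_cabs z : `|z| = (cabs z)%:C.
Proof. by case: z. Qed.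

Lemma cabs_ge0 z : 0 <= cabs z.
Proof. by case: z => a b; exact: sqrtr_ge0. Qed.

Lemma cabs0 : cabs (0 : C) = 0.
Proof. exact: ComplexField.Normc.normc0. Qed.

Lemma cabs1 : cabs (1 : C) = 1.
Proof. exact: ComplexField.Normc.normc1. Qed.

Lemma cabsM z w : cabs (z * w) = cabs z * cabs w.
Proof. exact: ComplexField.Normc.normcM. Qed.

Lemma cabsN z : cabs (- z) = cabs z.
Proof. by case: z => a b; rewrite /cabs /= !sqrrN. Qed.

Lemma cabsV z : cabs z^-1 = (cabs z)^-1.
Proof. exact: ComplexField.Normc.normcV. Qed.

Lemma cabs_eq0 z : cabs z = 0 -> z = 0.
Proof. exact: ComplexField.Normc.eq0_normc. Qed.

Lemma cabsD z w : cabs (z + w) <= cabs z + cabs w.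
Proof. by rewrite -lecR rmorphD /= -!normr_cabs ler_normD. Qed.

Lemma cabs_real (x : R) : cabs x%:C = `|x|.
Proof. by rewrite /cabs /= expr0n /= addr0 sqrtr_sqr. Qed.

Lemma cabs_normr z : cabs `|z| = cabs z.
Proof. by rewrite normr_cabs cabs_real ger0_norm ?cabs_ge0. Qed.

Lemma cabs_sqr z : cabs z ^+ 2 = complex.Re z ^+ 2 + complex.Im z ^+ 2.
Proof. by case: z => a b; rewrite /cabs /= sqr_sqrtr // addr_ge0 ?sqr_ge0. Qed.

Lemma cabs_sum (I : Type) (s : seq I) (P : pred I) (F : I -> C) :
  cabs (\sum_(i <- s | P i) F i) <= \sum_(i <- s | P i) cabs (F i).
Proof.
elim/big_rec2: _ => [|i x y _ h]; first by rewrite cabs0.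
by apply: le_trans (cabsD _ _) _; rewrite lerD2l.
Qed.

Lemma cabs_prod (I : Type) (s : seq I) (P : pred I) (F : I -> C) :
  cabs (\prod_(i <- s | P i) F i) = \prod_(i <- s | P i) cabs (F i).
Proof. by elim/big_rec2: _ => [|i x y _ <-]; rewrite ?cabs1 ?cabsM. Qed.

Lemma Re_le_cabs z : complex.Re z <= cabs z.
Proof.
apply: le_trans (ler_norm _) _.
by rewrite -(ler_pXn2r (n := 2)) ?nnegrE ?cabs_ge0 // cabs_sqr real_normK ?num_real // lerDl sqr_ge0.
Qed.

Lemma cabs_phase z : exists u : C, cabs u = 1 /\ u * z = (cabs z)%:C.
Proof.
have [->|z0] := eqVneq z 0; first by exists 1; rewrite cabs1 cabs0 mulr0.
have az0 : cabs z != 0 by apply: contra z0 => /eqP/cabs_eq0/eqP.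
exists ((cabs z)%:C / z); split; last by rewrite divfK.
by rewrite cabsM cabsV cabs_real ger0_norm ?cabs_ge0 // divff.
Qed.

End ComplexModulus.

(** * The complex Hahn-Banach theorem for a seminorm *)

Section HahnBanach.
Variable R : realType.
Local Notation C := R[i].
Variables (V : lmodType C) (p : V -> R).
Hypothesis pD : forall x y, p (x + y) <= p x + p y.
Hypothesis pZ : forall (a : C) x, p (a *: x) = cabs a * p x.

(* A real-linear functional on a real subspace, given by its graph; the bound
   by the seminorm p makes such a graph single-valued. *)
Definition dominated_graph (G : set (V * R)) :=
  [/\ forall x y, G x -> G y -> G (x.1 + y.1, x.2 + y.2),
      forall (t : R) x, G x -> G (t%:C *: x.1, t * x.2) &
      forall x, G x -> x.2 <= p x.1].

(** One-dimensional extension step. The value [al] at [v] has to satisfy u.2 - p (u.1 - v) <= al <=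
    p (u'.1 + v) - u'.2 for all u, u' in [G]. Subadditivity of [p] puts every left side below every
    right side, and [al] is the supremum of the left ones. *)
Lemma dominated_graph_extend (G : set (V * R)) (v : V) :
  G !=set0 -> dominated_graph G ->
  exists G', [/\ G `<=` G', dominated_graph G' & exists a, G' (v, a)].
Proof.
move=> [g0 Gg0] [GD GZ Gp].
have G0 : G (0, 0) by have := GZ 0 _ Gg0; rewrite scale0r mul0r.
pose S := [set u.2 - p (u.1 - v) | u in G].
have SleU u u' : G u -> G u' -> u.2 - p (u.1 - v) <= p (u'.1 + v) - u'.2.
  move=> Gu Gu'; have /= := Gp _ (GD _ _ Gu Gu'); have := pD (u.1 - v) (u'.1 + v).
  by rewrite addrACA addNr addr0; lra.
have supS : has_sup S.
  split; first by exists (0 - p (0 - v)), (0, 0).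
  by exists (p (0 + v) - 0) => _ [u Gu <-]; exact: (SleU _ (0, 0)).
pose al := sup S.
have al_ge u : G u -> u.2 - p (u.1 - v) <= al.
  by move=> Gu; apply: sup_upper_bound => //; exists u.
have al_le u : G u -> al <= p (u.1 + v) - u.2.
  move=> Gu; apply: ge_sup; first by case: supS.
  by move=> _ [u' Gu' <-]; exact: SleU.
exists [set w | exists u t, G u /\ w = (u.1 + t%:C *: v, u.2 + t * al)]; split.
- by move=> [u a] Gu; exists (u, a), 0; split => //=; rewrite scale0r mul0r !addr0.
- split.
  + move=> _ _ [u [t [Gu ->]]] [u' [t' [Gu' ->]]] /=.
    exists (u.1 + u'.1, u.2 + u'.2), (t + t'); split; first exact: GD.
    by rewrite /= rmorphD /= scalerDl mulrDl; congr pair; rewrite addrACA.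
  + move=> c _ [u [t [Gu ->]]] /=.
    exists (c%:C *: u.1, c * u.2), (c * t); split; first exact: GZ.
    by rewrite /= rmorphM /= scalerDr scalerA mulrDr mulrA.
  + move=> _ [u [t [Gu ->]]] /=.
    (* Dividing by |t| reduces negative [t] to the lower bound on [al] and positive [t] to the upper
       one. *)
    have [t0|t0|->] := ltgtP t 0; last by rewrite scale0r mul0r !addr0; exact: Gp.
    * have /= := al_ge _ (GZ (- t)^-1 _ Gu).
      have -> : u.1 + t%:C *: v = (- t)%:C *: ((- t)^-1%:C *: u.1 - v).
        rewrite scalerBr scalerA -rmorphM /= divff ?oppr_eq0 ?lt_eqF // scale1r.
        by rewrite rmorphN /= scaleNr opprK.
      rewrite pZ cabs_real gtr0_norm ?oppr_gt0 // => h.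
      rewrite -subr_ge0; have : 0 <= - t * (al - ((- t)^-1 * u.2 - p ((- t)^-1%:C *: u.1 - v))).
        by rewrite mulr_ge0 ?subr_ge0 // oppr_ge0 ltW.
      rewrite mulrBr mulrBr mulrA divff ?oppr_eq0 ?lt_eqF //; lra.
    * have /= := al_le _ (GZ t^-1 _ Gu).
      have -> : u.1 + t%:C *: v = t%:C *: (t^-1%:C *: u.1 + v).
        by rewrite scalerDr scalerA -rmorphM /= divff ?gt_eqF // scale1r.
      rewrite pZ cabs_real gtr0_norm // => h.
      rewrite -subr_ge0; have : 0 <= t * (p (t^-1%:C *: u.1 + v) - t^-1 * u.2 - al).
        by rewrite mulr_ge0 ?subr_ge0 // ltW.
      rewrite !mulrBr mulrA divff ?gt_eqF //; lra.
- by exists al, (0, 0), 1; split => //=; rewrite scale1r mul1r !add0r.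
Qed.

Lemma dominated_graph_total (G0 : set (V * R)) :
  G0 !=set0 -> dominated_graph G0 ->
  exists G, [/\ G0 `<=` G, dominated_graph G & forall v, exists a, G (v, a)].
Proof.
move=> G0n dG0.
pose P (X : set (V * R)) := X = set0 \/ (G0 `<=` X /\ dominated_graph X).
have [F FP Ftot|A [PA Amax]] := @Zorn_bigcup _ P.
  have [[X [FX [x Xx]]]|Fe] := pselect (exists X, F X /\ X !=set0); last first.
    left; apply/seteqP; split=> // x [X FX Xx].
    by apply: Fe; exists X; split => //; exists x.
  have good Y y : F Y -> Y y -> G0 `<=` Y /\ dominated_graph Y.
    by move=> FY Yy; have [Y0|] := FP _ FY; last exact; move: Yy; rewrite Y0.
  right; split; first by move=> y G0y; exists X => //; apply: (good _ _ FX Xx).1.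
  split.
  - move=> y y' [Y FY Yy] [Y' FY' Yy']; have [sub|sub] := Ftot _ _ FY FY'.
      exists Y' => //; have [_ [D _ _]] := good _ _ FY' Yy'; apply: D => //; exact: sub.
    exists Y => //; have [_ [D _ _]] := good _ _ FY Yy; apply: D => //; exact: sub.
  - move=> t y [Y FY Yy]; exists Y => //; have [_ [_ Z _]] := good _ _ FY Yy; exact: Z.
  - by move=> y [Y FY Yy]; have [_ [_ _]] := good _ _ FY Yy; exact.
have [G0A dA] : G0 `<=` A /\ dominated_graph A.
  case: PA => // A0; exfalso; apply: (Amax G0); last by right; split.
  by rewrite A0; split => //; case: G0n => x G0x /(_ _ G0x).
exists A; split => // v; apply: contrapT => nv.
have An : A !=set0 by case: G0n => x /G0A; exists x.
have [A' [AA' dA' [a A'a]]] := dominated_graph_extend v An dA.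
apply: (Amax A'); last by right; split => //; exact: subset_trans AA'.
by split => // /(_ _ A'a) Ava; apply: nv; exists a.
Qed.

Lemma dominated_graph_fun (G : set (V * R)) v a b : dominated_graph G ->
  G (v, a) -> G (v, b) -> a = b.
Proof.
move=> [GD GZ Gp].
have le x y : G (v, x) -> G (v, y) -> x <= y.
  move=> Gx Gy; have /= := Gp _ (GD _ _ Gx (GZ (-1) _ Gy)).
  have -> : v + (-1)%:C *: v = (0 : C) *: v by rewrite rmorphN1 scaleN1r subrr scale0r.
  by rewrite pZ cabs0 mul0r; lra.
by move=> Ga Gb; apply/eqP; rewrite eq_le !le.
Qed.

(** The real part of [phi] is extended to a real-linear [f], and the complex functional is recovered
    as Phi v = f v - i f (i v). The linear map [emb] takes the place of the inclusion of a
    subspace. *)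
Lemma hahn_banach (E : lmodType C) (emb : {linear E -> V}) (phi : {linear E -> C^o}) :
  (forall c, cabs (phi c : C) <= p (emb c)) ->
  exists Phi : {linear V -> C^o},
    (forall c, Phi (emb c) = phi c) /\ (forall v, cabs (Phi v : C) <= p v).
Proof.
move=> phi_le.
pose G0 := [set w | exists c, w = (emb c, complex.Re (phi c : C))].
have G0n : G0 !=set0 by exists (emb 0, complex.Re (phi 0 : C)), 0.
have ReD (x y : C) : complex.Re (x + y) = complex.Re x + complex.Re y by case: x y => ? ? [].
have ReZ (t : R) (x : C) : complex.Re (t%:C * x) = t * complex.Re x.
  by case: x => a b /=; rewrite mul0r subr0.
have dG0 : dominated_graph G0; first split.
- by move=> _ _ [c ->] [d ->] /=; exists (c + d); rewrite -ReD !linearD.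
- by move=> t _ [c ->] /=; exists (t%:C *: c); rewrite -ReZ !linearZ.
- by move=> _ [c ->] /=; apply: le_trans (Re_le_cabs _) (phi_le c).
have [G [G0G dG Gtot]] := dominated_graph_total G0n dG0.
have [f fG] := choice Gtot; have [GD GZ Gp] := dG.
have fuq v a : G (v, a) -> f v = a by move=> Ga; exact: dominated_graph_fun dG (fG v) Ga.
have fD x y : f (x + y) = f x + f y by apply: fuq; exact: GD (fG x) (fG y).
have fZ (t : R) x : f (t%:C *: x) = t * f x by apply: fuq; exact: GZ (fG x).
pose Ph (v : V) : C^o := f v +i* (- f ('i *: v)).
have fi v : f ('i *: ('i *: v)) = - f v.
  have -> : 'i *: ('i *: v) = (-1)%:C *: v by rewrite scalerA -expr2 sqr_i rmorphN1.
  by rewrite fZ mulN1r.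
have PhL : linear Ph.
  move=> a x y; rewrite [a]complexE scalerDl -scalerA -addrA /Ph.
  rewrite !(scalerDr 'i) !fD !fZ.
  have -> : f ('i *: ((complex.Im a)%:C *: x)) = complex.Im a * f ('i *: x).
    by rewrite scalerA mulrC -scalerA fZ.
  have -> : f ('i *: ((complex.Re a)%:C *: x)) = complex.Re a * f ('i *: x).
    by rewrite scalerA mulrC -scalerA fZ.
  have -> : f ('i *: ('i *: ((complex.Im a)%:C *: x))) = - (complex.Im a * f x) by rewrite fi fZ.
  case: a => a b /=; rewrite /GRing.scale /=.
  by apply/eqP; rewrite eq_complex /=; apply/andP; split; apply/eqP; ring.
pose PhM := GRing.isLinear.Build _ _ _ _ Ph PhL.
pose Phi : {linear V -> C^o} := HB.pack Ph PhM.
exists Phi; split.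
- move=> c; rewrite /Phi /= /Ph.
  have fe d : f (emb d) = complex.Re (phi d : C) by apply: fuq; apply: G0G; exists d.
  rewrite -linearZ /= !fe linearZ /= /GRing.scale /=.
  by case: (phi c) => a b /=; apply/eqP; rewrite eq_complex /=; apply/andP; split; apply/eqP; ring.
(* A unimodular factor [u] makes the value real and nonnegative, so that the bound of [f] by [p]
   applies to it. *)
- move=> v; have [u [u1 uP]] := cabs_phase (Phi v : C).
  have -> : cabs (Phi v : C) = complex.Re (Phi (u *: v) : C).
    by rewrite linearZ /= /GRing.scale /= uP.
  by rewrite /Phi /= /Ph /=; apply: le_trans (Gp _ (fG _)) _; rewrite /= pZ u1 mul1r.
Qed.

End HahnBanach.

(** * Criteria for upper bounds of the projection constant and of chi_mon *)

Section ProjectionConstant.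
Variable R : realType.
Local Notation C := R[i].
Variables (nrm : forall n : nat, ('I_n -> C) -> R) (n : nat) (J : {fset multi_index n}).

Lemma poly_norm_ge (c : J -> C) z : nrm z < 1 ->
  ((cabs (poly_eval c z))%:E <= poly_norm nrm c)%E.
Proof. by move=> hz; apply: ereal_sup_ubound; exists z. Qed.

Lemma poly_eval_sum (I : finType) (a : I -> C) (g : I -> J -> C) z :
  poly_eval (fun b => \sum_i a i * g i b) z = \sum_i a i * poly_eval (g i) z.
Proof.
rewrite /poly_eval; under eq_bigr do rewrite mulr_suml.
rewrite exchange_big; apply: eq_bigr => i _; rewrite mulr_sumr.
by apply: eq_bigr => b _; rewrite mulrA.
Qed.

Lemma poly_eval_linear (z : 'I_n -> C) :
  linear ((fun c : {ffun J -> C^o} => poly_eval c z) : _ -> C^o).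
Proof.
move=> a c d; rewrite /poly_eval scaler_sumr -big_split; apply: eq_bigr => b _ /=.
by rewrite !ffunE mulrDl /GRing.scale /= mulrA.
Qed.

Lemma emb_linear (Y : normedModType C) (y : J -> Y) :
  linear (fun c : {ffun J -> C^o} => emb y c).
Proof.
move=> a c d; rewrite /emb scaler_sumr -big_split; apply: eq_bigr => b _ /=.
by rewrite !ffunE scalerDl scalerA.
Qed.

(* By Hahn-Banach each point evaluation at y i extends to a functional
   Phi i of norm at most 1 on Y, and Q v := \sum_i Phi i v * g i is then the projection. *)
Lemma proj_const_le (I : finType) (y : I -> 'I_n -> C) (g : I -> J -> C) (B : R) :
  (forall i, nrm (y i) < 1) ->
  (forall (c : J -> C) a, c a = \sum_i poly_eval c (y i) * g i a) ->
  (forall z, nrm z < 1 -> \sum_i cabs (poly_eval (g i) z) <= B) ->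
  (proj_const nrm J <= B%:E)%E.
Proof.
move=> y1 rec gB; apply: ge_ereal_sup => _ [Y [e [isoe ->]]].
pose p (v : Y) := cabs `|v|.
have pD u v : p (u + v) <= p u + p v.
  rewrite /p -lecR rmorphD /= -!normr_cabs !normr_id; exact: ler_normD.
have pZ a v : p (a *: v) = cabs a * p v.
  by rewrite /p normrZ cabsM cabs_normr.
pose embM := GRing.isLinear.Build _ _ _ _ (fun c : {ffun J -> C^o} => emb e c) (emb_linear e).
pose embL : {linear {ffun J -> C^o} -> Y} := HB.pack (fun c : {ffun J -> C^o} => emb e c) embM.
have extend i : exists Phi : {linear Y -> C^o},
    (forall c : {ffun J -> C^o}, Phi (emb e c) = poly_eval c (y i)) /\
    (forall v, cabs (Phi v : C) <= p v).
  pose phM := GRing.isLinear.Build _ _ _ _ _ (poly_eval_linear (y i)).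
  pose ph : {linear {ffun J -> C^o} -> C^o} :=
    HB.pack ((fun c : {ffun J -> C^o} => poly_eval c (y i)) : _ -> C^o) phM.
  apply: (@hahn_banach R Y p pD pZ _ embL ph) => c /=.
  by rewrite -lee_fin isoe; exact: poly_norm_ge.
have [Phi PhiP] := choice extend.
pose co v (a : J) : C := \sum_i (Phi i v : C) * g i a.
have Qlin : linear (fun v => emb e (co v)).
  move=> a u v; rewrite /emb scaler_sumr -big_split; apply: eq_bigr => b _ /=.
  rewrite scalerA -scalerDl; congr (_ *: _); rewrite /co mulr_sumr -big_split.
  by apply: eq_bigr => i _ /=; rewrite linearP /= mulrDl /GRing.scale /= mulrA.
pose QM := GRing.isLinear.Build _ _ _ _ _ Qlin.
pose Q : {linear Y -> Y} := HB.pack (fun v => emb e (co v)) QM.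
apply: (@le_trans _ _ (op_norm Q)).
  apply: ereal_inf_lbound; exists Q => //; split=> [x|c]; first by exists (co x).
  apply: eq_bigr => a _; congr (_ *: _); rewrite /co [RHS]rec.
  apply: eq_bigr => i _; congr (_ * _).
  have emb_ffun : emb e (finfun (c : J -> C^o)) = emb e c.
    by apply: eq_bigr => b _; rewrite ffunE.
  rewrite -emb_ffun (PhiP i).1; apply: eq_bigr => b _; congr (_ * _).
  by rewrite ffunE.
apply: ge_ereal_sup => _ [v v1 <-]; rewrite isoe.
apply: ge_ereal_sup => _ [z z1 <-]; rewrite lee_fin poly_eval_sum.
apply: le_trans (cabs_sum _ _ _) _; apply: le_trans (gB z z1).
apply: ler_sum => i _; rewrite cabsM ler_piMl ?cabs_ge0 //.
apply: le_trans ((PhiP i).2 v) _; rewrite /p -lecR -normr_cabs normr_id.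
exact: v1.
Qed.

(** The sum of the moduli of the terms does not change under the factors [eps], so it is enough to
    bound this sum at every point of the ball. *)
Lemma chi_mon_le (K : R) : 0 < K ->
  (forall (c : J -> C) z (M : R), nrm z < 1 ->
     (forall y, nrm y < 1 -> cabs (poly_eval c y) <= M) ->
     \sum_(a : J) cabs (c a) * cabs (mon (fsval a) z) <= K * M) ->
  (chi_mon nrm J <= K%:E)%E.
Proof.
move=> K0 H; apply: ereal_inf_lbound; exists K => //; split; first exact: ltW.
move=> c eps eps1; apply: ge_ereal_sup => _ [z z1 <-].
have := poly_norm_ge c z1.
case E : (poly_norm nrm c) => [M| |]; last by rewrite leeNy_eq.
- move=> _; rewrite -EFinM lee_fin.
  apply: le_trans (H c z M z1 _); last first.
    by move=> y /(poly_norm_ge c); rewrite E lee_fin.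
  apply: le_trans (cabs_sum _ _ _) _; apply: ler_sum => a _.
  by rewrite !cabsM eps1 mul1r.
- by move=> _; rewrite gt0_muley ?lte_fin // leey.
Qed.

End ProjectionConstant.

(** * Cauchy-Schwarz and sums over subsets *)

Section FiniteSums.
Variable R : realType.

(** Lagrange's identity: the double sum of the squared 2x2 minors is twice the difference of the two
    sides. *)
Lemma cauchy_schwarz (I : finType) (x y : I -> R) :
  (\sum_i x i * y i) ^+ 2 <= (\sum_i x i ^+ 2) * (\sum_i y i ^+ 2).
Proof.
have : 0 <= \sum_i \sum_j (x i * y j - x j * y i) ^+ 2.
  by apply: sumr_ge0 => i _; apply: sumr_ge0 => j _; exact: sqr_ge0.
have -> : \sum_i \sum_j (x i * y j - x j * y i) ^+ 2 =
    \sum_i \sum_j (x i ^+ 2 * y j ^+ 2) + \sum_i \sum_j (y i ^+ 2 * x j ^+ 2)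
    - 2 * \sum_i \sum_j (x i * y i) * (x j * y j).
  rewrite mulr_sumr -big_split -sumrB /=; apply: eq_bigr => i _.
  rewrite mulr_sumr -big_split -sumrB /=; apply: eq_bigr => j _; ring.
rewrite -!big_distrlr /= expr2 (mulrC (\sum_i y i ^+ 2)); lra.
Qed.

Lemma cauchy_schwarz_le (I : finType) (x y : I -> R) (a b : R) : 0 <= a -> 0 <= b ->
  \sum_i x i ^+ 2 <= a ^+ 2 -> \sum_i y i ^+ 2 <= b ^+ 2 -> \sum_i x i * y i <= a * b.
Proof.
move=> a0 b0 xa yb; apply: le_trans (ler_norm _) _.
rewrite -(ler_pXn2r (n := 2)) ?nnegrE ?mulr_ge0 // real_normK ?num_real // exprMn.
apply: le_trans (cauchy_schwarz x y) _; apply: ler_pM => //.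
  by apply: sumr_ge0 => i _; exact: sqr_ge0.
by apply: sumr_ge0 => i _; exact: sqr_ge0.
Qed.

(** Lets the inductions on a set of coordinates split off one coordinate at a time. *)
Lemma sum_subset_setU1 (V : nmodType) (T : finType) (S : {set T}) (i : T)
    (h : {set T} -> V) : i \notin S ->
  \sum_(A : {set T} | A \subset i |: S) h A =
  \sum_(A : {set T} | A \subset S) (h A + h (i |: A)).
Proof.
move=> iS; rewrite big_split /= (bigID (fun A : {set T} => i \in A)) /= addrC.
have notin (A : {set T}) : A \subset S -> i \notin A by move=> /fintype.subsetP AS; apply: contra iS => /AS.
congr (_ + _).
  apply: eq_bigl => A; apply/andP/idP => [[sA iA]|sA].
    apply/fintype.subsetP => x xA; have := fintype.subsetP sA x xA; rewrite !inE => /predU1P[xi|//].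
    by rewrite -xi xA in iA.
  by split; [exact: fintype.subset_trans sA (finset.subsetUr _ _) | exact: notin].
rewrite (reindex_onto (fun A => i |: A) (fun A => A :\ i)) /=; last first.
  by move=> A /andP[_ iA]; rewrite finset.setD1K.
apply: eq_bigl => A; rewrite !inE eqxx /= andbT; apply/andP/idP => [[AS /eqP e]|AS].
  apply/fintype.subsetP => x xA; have : x \in A by [].
  rewrite -e !inE => /andP[xi _]; have := fintype.subsetP AS x.
  by rewrite !inE xA orbT (negPf xi) /= => /(_ isT).
by split; [exact: finset.setUS | rewrite finset.setU1K // notin].
Qed.

End FiniteSums.

(** * Walsh functions, Parseval's identity and Bonami's inequality *)

Section Walsh.
Variables (R : realType) (T : finType).
Local Notation C := R[i].
Implicit Types (A B S : {set T}) (w : {ffun T -> bool}) (f : {set T} -> C).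

(** The characters of the sign group {-1, 1}^T; [w i = true] stands for the sign -1. *)
Definition walsh A w : C := \prod_(i in A) (-1) ^+ (w i).

Definition flip (j : T) w : {ffun T -> bool} := [ffun i => (i == j) (+) w i].

Definition walsh_sum S f w : C := \sum_(A : {set T} | A \subset S) f A * walsh A w.

Definition cube_size : R := #|{ffun T -> bool}|%:R.

Lemma cube_size_gt0 : 0 < cube_size.
Proof. by rewrite /cube_size ltr0n; apply/card_gt0P; exists [ffun=> true]. Qed.

Lemma flipK j : involutive (flip j).
Proof. by move=> w; apply/ffunP => i; rewrite !ffunE addbA addbb. Qed.

Lemma walsh_flip A j w : walsh A (flip j w) = (if j \in A then -1 else 1) * walsh A w.
Proof.
rewrite /walsh; case: ifPn => jA.
  rewrite (bigD1 j jA) [in RHS](bigD1 j jA) mulrA; congr (_ * _).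
    by rewrite ffunE eqxx; case: (w j); rewrite /= ?expr0 ?expr1 ?mulr1 // mulrNN mulr1.
  by apply: eq_bigr => i /andP[_ /negPf ij]; rewrite ffunE ij.
rewrite mul1r; apply: eq_bigr => i iA; rewrite ffunE.
by case: eqP => // ij; rewrite ij (negPf jA) in iA.
Qed.

Lemma walsh_sqr A w : walsh A w * walsh A w = 1.
Proof.
rewrite /walsh -big_split /= big1 // => i _.
by case: (w i); rewrite /= ?expr0 ?expr1 ?mulr1 // mulrNN mulr1.
Qed.

Lemma cabs_walsh A w : cabs (walsh A w) = 1.
Proof. by rewrite /walsh cabs_prod big1 // => i _; case: (w i); rewrite ?expr1 ?cabsN cabs1. Qed.

Lemma walsh_setU1 A i w : i \notin A -> walsh (i |: A) w = (-1) ^+ (w i) * walsh A w.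
Proof. by move=> iA; rewrite /walsh big_setU1. Qed.

(** For distinct sets, flipping a coordinate of the symmetric difference reverses the sign of every
    product, so the sum equals its own negative. *)
Lemma walsh_orthogonal A B :
  \sum_w walsh A w * walsh B w = if A == B then cube_size%:C else 0.
Proof.
case: eqVneq => [->|AB].
  by under eq_bigr do rewrite walsh_sqr; rewrite sumr_const /cube_size rmorph_nat.
have [j jAB] : exists j, (j \in A) != (j \in B).
  by apply/existsP; rewrite -negb_forall; apply: contra AB => /forallP h; apply/eqP/setP => j; apply/eqP.
set s := \sum_w _; have : s = - s.
  rewrite {1}/s (reindex_inj (inv_inj (flipK j))) /= -sumrN; apply: eq_bigr => w _.
  rewrite !walsh_flip; case: (j \in A) jAB; case: (j \in B) => // _; ring.
by move=> /eqP; rewrite -addr_eq0 -mulr2n mulrn_eq0 => /eqP.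
Qed.

Lemma walsh_coef f A :
  \sum_w walsh A w * (\sum_B f B * walsh B w) = cube_size%:C * f A.
Proof.
under eq_bigr do rewrite mulr_sumr.
rewrite exchange_big (bigD1 A) //= [X in _ + X]big1 ?addr0 => [|B BA].
  under eq_bigr do rewrite mulrCA.
  by rewrite -mulr_sumr walsh_orthogonal eqxx mulrC.
under eq_bigr do rewrite mulrCA.
by rewrite -mulr_sumr walsh_orthogonal eq_sym (negPf BA) mulr0.
Qed.

Lemma walsh_sum_setU1 S i f w : i \notin S ->
  walsh_sum (i |: S) f w =
  walsh_sum S f w + (-1) ^+ (w i) * walsh_sum S (fun A => f (i |: A)) w.
Proof.
move=> iS; rewrite /walsh_sum sum_subset_setU1 // big_split /=; congr (_ + _).
rewrite mulr_sumr; apply: eq_bigr => A sAS.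
have iA : i \notin A by apply: contra iS; exact: (fintype.subsetP sAS).
by rewrite (walsh_setU1 _ iA) mulrCA.
Qed.

Lemma walsh_sum_flip S i f w : i \notin S -> walsh_sum S f (flip i w) = walsh_sum S f w.
Proof.
move=> iS; apply: eq_bigr => A sAS.
have iA : i \notin A by apply: contra iS; exact: (fintype.subsetP sAS).
by rewrite walsh_flip (negPf iA) mul1r.
Qed.

Lemma parallelogram (a b : C) :
  cabs (a + b) ^+ 2 + cabs (a - b) ^+ 2 = 2 * (cabs a ^+ 2 + cabs b ^+ 2).
Proof. by rewrite !cabs_sqr; case: a => ? ?; case: b => ? ? /=; ring. Qed.

(** The gap between the two sides is 8 times the square of the imaginary part of conj(a) b. *)
Lemma fourth_power_two_point (a b : C) :
  cabs (a + b) ^+ 4 + cabs (a - b) ^+ 4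
  <= 2 * (cabs a ^+ 4 + cabs b ^+ 4 + 6 * (cabs a ^+ 2 * cabs b ^+ 2)).
Proof.
rewrite !(exprM _ 2 2) !cabs_sqr; case: a => x y; case: b => u v /=.
rewrite -subr_ge0.
have -> : 2 * ((x ^+ 2 + y ^+ 2) ^+ 2 + (u ^+ 2 + v ^+ 2) ^+ 2 +
    6 * ((x ^+ 2 + y ^+ 2) * (u ^+ 2 + v ^+ 2))) -
    (((x + u) ^+ 2 + (y + v) ^+ 2) ^+ 2 + ((x - u) ^+ 2 + (y - v) ^+ 2) ^+ 2)
    = 8 * (x * v - y * u) ^+ 2 by ring.
by rewrite mulr_ge0 // sqr_ge0.
Qed.

Lemma sum_flip_pair (F : {ffun T -> bool} -> R) i :
  \sum_w F w = \sum_w (F w + F (flip i w)) / 2.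
Proof.
rewrite -mulr_suml big_split /=.
have <- : \sum_w F w = \sum_w F (flip i w) by exact: reindex_inj (inv_inj (flipK i)).
lra.
Qed.

Lemma flip_sum_signs S i f w : i \notin S ->
  walsh_sum (i |: S) f (flip i w) =
  walsh_sum S f w - (-1) ^+ (w i) * walsh_sum S (fun A => f (i |: A)) w.
Proof.
move=> iS; rewrite walsh_sum_setU1 // !walsh_sum_flip // ffunE eqxx /=.
by case: (w i); rewrite /= ?expr0 ?expr1; ring.
Qed.

Lemma cabs_signM (b : bool) (z : C) : cabs ((-1) ^+ b * z) = cabs z.
Proof. by case: b; rewrite ?expr0 ?expr1 ?mulN1r ?cabsN ?mul1r. Qed.

(** Induction on [S]: averaging over the sign of one coordinate separates the sets with and without
    it, by the parallelogram law. *)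
Lemma walsh_parseval S f :
  \sum_w cabs (walsh_sum S f w) ^+ 2 =
  cube_size * \sum_(A : {set T} | A \subset S) cabs (f A) ^+ 2.
Proof.
elim: {S}#|S| {-2}S (erefl #|S|) f => [|k IH] S.
  move=> /cards0_eq -> f; rewrite (big_pred1 finset.set0) => [|A]; last by rewrite finset.subset0.
  under eq_bigr => w _.
    rewrite /walsh_sum (big_pred1 finset.set0) => [|A]; last by rewrite finset.subset0.
    rewrite cabsM cabs_walsh mulr1; over.
  by rewrite sumr_const -mulr_natl.
move=> Sk f; have [i iS] : exists i, i \in S by apply/card_gt0P; rewrite Sk.
have iS' : i \notin S :\ i by rewrite !inE eqxx.
have S'k : #|S :\ i| = k by move: Sk; rewrite (cardsD1 i) iS add1n => -[].
rewrite -(finset.setD1K iS) (sum_flip_pair _ i) sum_subset_setU1 // big_split /= mulrDr.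
rewrite -(IH _ S'k f) -(IH _ S'k (fun A => f (i |: A))) -big_split /=.
apply: eq_bigr => w _; rewrite flip_sum_signs // walsh_sum_setU1 // parallelogram.
by rewrite cabs_signM mulrC mulKf.
Qed.

(* Bonami's two-point inequality, tensorised by induction on S. *)
Lemma walsh_fourth_moment S f :
  \sum_w cabs (walsh_sum S f w) ^+ 4 <=
  cube_size * (\sum_(A : {set T} | A \subset S) 3 ^+ #|A| * cabs (f A) ^+ 2) ^+ 2.
Proof.
elim: {S}#|S| {-2}S (erefl #|S|) f => [|k IH] S.
  move=> /cards0_eq -> f; rewrite (big_pred1 finset.set0) => [|A]; last by rewrite finset.subset0.
  under eq_bigr => w _.
    rewrite /walsh_sum (big_pred1 finset.set0) => [|A]; last by rewrite finset.subset0.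
    rewrite cabsM cabs_walsh mulr1; over.
  by rewrite sumr_const -[leLHS]mulr_natl cards0 expr0 mul1r -(exprM _ 2 2).
move=> Sk f; have [i iS] : exists i, i \in S by apply/card_gt0P; rewrite Sk.
have iS' : i \notin S :\ i by rewrite !inE eqxx.
have S'k : #|S :\ i| = k by move: Sk; rewrite (cardsD1 i) iS add1n => -[].
rewrite -(finset.setD1K iS) (sum_flip_pair _ i) sum_subset_setU1 // big_split /=.
set S' := S :\ i; pose fi A := f (i |: A).
set a := \sum_(A : {set T} | _) _; set b := \sum_(A : {set T} | _) _.
pose b' := \sum_(A : {set T} | A \subset S') 3 ^+ #|A| * cabs (fi A) ^+ 2.
have -> : b = 3 * b'.
  rewrite /b mulr_sumr; apply: eq_bigr => A sAS.
  have iA : i \notin A by apply: contra iS'; exact: (fintype.subsetP sAS).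
  by rewrite cardsU1 iA add1n exprS mulrA.
have N0 := ltW cube_size_gt0.
have wpos (h : {set T} -> C) : 0 <= \sum_(A : {set T} | A \subset S') 3 ^+ #|A| * cabs (h A) ^+ 2.
  by apply: sumr_ge0 => A _; rewrite mulr_ge0 ?exprn_ge0 ?cabs_ge0.
have a0 : 0 <= a by exact: wpos.
have b0 : 0 <= b' by exact: wpos.
pose G w := cabs (walsh_sum S' f w); pose H w := cabs (walsh_sum S' fi w).
have EG : \sum_w G w ^+ 4 <= cube_size * a ^+ 2 by exact: IH.
have EH : \sum_w H w ^+ 4 <= cube_size * b' ^+ 2 by exact: IH.
have EGH : \sum_w G w ^+ 2 * H w ^+ 2 <= cube_size * (a * b').
  have -> : cube_size * (a * b') = (Num.sqrt cube_size * a) * (Num.sqrt cube_size * b').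
    by rewrite mulrACA -expr2 sqr_sqrtr.
  apply: cauchy_schwarz_le; rewrite ?mulr_ge0 ?sqrtr_ge0 //.
    by rewrite exprMn sqr_sqrtr //; under eq_bigr do rewrite -exprM.
  by rewrite exprMn sqr_sqrtr //; under eq_bigr do rewrite -exprM.
apply: (@le_trans _ _ (\sum_w (G w ^+ 4 + H w ^+ 4 + 6 * (G w ^+ 2 * H w ^+ 2)))).
  apply: ler_sum => w _; rewrite flip_sum_signs // walsh_sum_setU1 //.
  have := fourth_power_two_point (walsh_sum S' f w) ((-1) ^+ (w i) * walsh_sum S' fi w).
  rewrite cabs_signM -/(G w) -/(H w); lra.
rewrite !big_split /= -mulr_sumr.
(* The weight 3 on the sets containing [i] is what closes the induction: a^2 + 6 a b' + b'^2 is at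
   most (a + 3 b')^2. *)
apply: (@le_trans _ _ (cube_size * (a ^+ 2 + b' ^+ 2 + 6 * (a * b')))); first lra.
apply: ler_wpM2l => //; have : 0 <= b' ^+ 2 by exact: sqr_ge0.
lra.
Qed.

(** Pointwise interpolation of L^2 between L^1 and L^4: the first term suffices when t <= c, the
    second when t > c. *)
Lemma square_le_first_fourth (c t : R) : 0 < c -> 0 <= t -> t ^+ 2 <= c * t + t ^+ 4 / c ^+ 2.
Proof.
move=> c0 t0; have c2 : 0 < c ^+ 2 by rewrite exprn_gt0.
have [tc|ct] := leP t c.
  rewrite expr2; apply: (@le_trans _ _ (c * t)); first by rewrite ler_wpM2r.
  by rewrite lerDl divr_ge0 ?exprn_ge0 // ltW.
apply: (@le_trans _ _ (t ^+ 4 / c ^+ 2)); last by rewrite lerDr mulr_ge0 // ltW.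
rewrite ler_pdivlMr // (exprD t 2 2).
by rewrite ler_wpM2l ?exprn_ge0 // ler_pXn2r ?nnegrE // ltW.
Qed.

(** The loss is only exponential in the degree, so the factor C^m of the final bounds can absorb
    it. *)
Lemma walsh_l2_le_l1 (d : nat) f : (forall A, (d < #|A|)%N -> f A = 0) ->
  Num.sqrt (\sum_A cabs (f A) ^+ 2) <=
  3 ^+ d.+1 * (\sum_w cabs (\sum_A f A * walsh A w) / cube_size).
Proof.
move=> fd; set Q := \sum_A _; set s := Num.sqrt Q.
have Q0 : 0 <= Q by apply: sumr_ge0 => A _; rewrite exprn_ge0 ?cabs_ge0.
have s2 : s ^+ 2 = Q by rewrite sqr_sqrtr.
have N0 := cube_size_gt0.
pose F w := cabs (\sum_A f A * walsh A w).
have F0 w : 0 <= F w by exact: cabs_ge0.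
rewrite -mulr_suml -/(\sum_w F w); set L := \sum_w F w.
have L0 : 0 <= L by exact: sumr_ge0.
have : 0 <= s by rewrite sqrtr_ge0.
rewrite le_eqVlt => /predU1P[<-|s0].
  by rewrite mulr_ge0 ?exprn_ge0 // divr_ge0 ?sumr_ge0 // ltW.
have full w : \sum_A f A * walsh A w = walsh_sum [set: T]%SET f w.
  by apply: eq_bigl => A; rewrite finset.subsetT.
have full2 (h : {set T} -> R) : \sum_A h A = \sum_(A : {set T} | A \subset [set: T]%SET) h A.
  by apply: eq_bigl => A; rewrite finset.subsetT.
have M2 : \sum_w F w ^+ 2 = cube_size * Q.
  by rewrite /F; under eq_bigr do rewrite full; rewrite walsh_parseval -full2.
have M4 : \sum_w F w ^+ 4 <= cube_size * (3 ^+ d * Q) ^+ 2.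
  rewrite /F; under eq_bigr do rewrite full.
  apply: le_trans (walsh_fourth_moment _ _) _; rewrite -full2.
  apply: ler_wpM2l; first exact: ltW.
  rewrite ler_pXn2r ?nnegrE //; first last.
  - by rewrite mulr_ge0 ?exprn_ge0.
  - by apply: sumr_ge0 => A _; rewrite mulr_ge0 ?exprn_ge0 ?cabs_ge0.
  rewrite mulr_sumr; apply: ler_sum => A _.
  have [dA|Ad] := ltnP d #|A|; first by rewrite fd // cabs0 expr0n /= !mulr0.
  by rewrite ler_wpM2r ?exprn_ge0 ?cabs_ge0 // ler_weXn2l // ler1n.
(* With this threshold the fourth moment contributes at most a quarter of the second moment and
   moves to the left side. What remains is s <= (8/3) 3^d times the mean of [F], and 8/3 <= 3. *)
pose c := 2 * 3 ^+ d * s; have c0 : 0 < c by rewrite /c !mulr_gt0 ?exprn_gt0.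
have : \sum_w F w ^+ 2 <= \sum_w (c * F w + F w ^+ 4 / c ^+ 2).
  by apply: ler_sum => w _; exact: square_le_first_fourth.
rewrite big_split /= -mulr_sumr -mulr_suml M2 -/L => h.
have : (\sum_w F w ^+ 4) / c ^+ 2 <= cube_size * Q / 4.
  rewrite ler_pdivrMr ?exprn_gt0 //; apply: le_trans M4 _.
  rewrite /c -s2 le_eqVlt; apply/orP; left; apply/eqP; field.
  by rewrite ?expf_neq0 ?lt0r_neq0.
move=> h2.
have {h h2} : cube_size * s * (3 / 4) * s <= 2 * 3 ^+ d * L * s.
  by move: h h2; rewrite /c -s2; lra.
rewrite ler_pM2r // => h.
rewrite exprS mulrA ler_pdivlMr //.
have : 0 <= 3 ^+ d * L by rewrite mulr_ge0 ?exprn_ge0.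
lra.
Qed.

End Walsh.

(** * Cauchy estimates for polynomials in one variable *)

Section CauchyEstimate.
Variable R : realType.
Local Notation C := R[i].
Implicit Types p : {poly C}.

Lemma unimodular_sqrt (t : C) : cabs t = 1 -> exists s, cabs s = 1 /\ s ^+ 2 = t.
Proof.
move=> t1; exists (sqrtC t); rewrite sqrtCK; split => //.
apply/eqP; rewrite -(eqrXn2 (n := 2)) ?cabs_ge0 // expr1n expr2 -cabsM -expr2 sqrtCK.
by rewrite t1.
Qed.

Lemma even_poly_horner p (t : C) : 2 * (even_poly p).[t ^+ 2] = p.[t] + p.[- t].
Proof.
rewrite -{2 3}(poly_even_odd p) !hornerD !hornerM !horner_comp !hornerX !hornerXn sqrrN; ring.
Qed.

Lemma odd_poly_horner p (t : C) : 2 * t * (odd_poly p).[t ^+ 2] = p.[t] - p.[- t].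
Proof.
rewrite -{2 3}(poly_even_odd p) !hornerD !hornerM !horner_comp !hornerX !hornerXn sqrrN; ring.
Qed.

Lemma cabs_half_le (a b c u : C) (M : R) : cabs u = 1 -> 2 * u * a = b + c ->
  cabs b <= M -> cabs c <= M -> cabs a <= M.
Proof.
move=> u1 /(congr1 (@cabs R)); rewrite !cabsM u1 mulr1 => e bM cM.
have c2 : cabs (2 : C) = 2.
  by have := cabs_real (2 : R); rewrite rmorph_nat ger0_norm.
by have := cabsD b c; move: e; rewrite c2; lra.
Qed.

(* Halving the degree by averaging over t and -t replaces the usual average
   over roots of unity. *)
Lemma coef0_le_circle p (M : R) :
  (forall t, cabs t = 1 -> cabs p.[t] <= M) -> cabs p`_0 <= M.
Proof.
elim: {p}(size p) {-2}p (leqnn (size p)) M => [|k IH] p sp M pM.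
  move: sp; rewrite leqn0 size_poly_eq0 => /eqP p0.
  by move: (pM 1 (cabs1 R)); rewrite p0 coef0 horner0.
(* A constant has size 1 = uphalf 1, where passing to the even part would not decrease the size. *)
have [s1|s1] := leqP (size p) 1.
  by move: (pM 1 (cabs1 R)); rewrite (size1_polyC s1) hornerC coefC.
have -> : p`_0 = (even_poly p)`_0 by rewrite coef_even_poly.
apply: IH => [|t t1].
  apply: leq_trans (size_even_poly p) _; rewrite -ltnS; apply: leq_trans sp.
  by rewrite uphalf_half; have := odd_double_half (size p); lia.
have [s [s1' <-]] := unimodular_sqrt t1.
apply: (@cabs_half_le _ p.[s] p.[- s] 1); rewrite ?cabs1 ?mulr1 ?even_poly_horner //.
  exact: pM.
by apply: pM; rewrite cabsN.
Qed.

(** The linear coefficient is the constant coefficient of the odd part, and t times the odd part at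
    t^2 is the average of p(t) and -p(-t). *)
Lemma coef1_le_circle p (M : R) :
  (forall t, cabs t = 1 -> cabs p.[t] <= M) -> cabs p`_1 <= M.
Proof.
move=> pM; have -> : p`_1 = (odd_poly p)`_0 by rewrite coef_odd_poly.
apply: coef0_le_circle => t t1; have [s [s1 <-]] := unimodular_sqrt t1.
apply: (@cabs_half_le _ p.[s] (- p.[- s]) s) => //; first exact: odd_poly_horner.
  exact: pM.
by rewrite cabsN; apply: pM; rewrite cabsN.
Qed.

(** The product rule at 0: one affine factor is differentiated at a time. *)
Lemma coef1_prod_affine (I : eqType) (s : seq I) (y u : I -> C) : uniq s ->
  (\prod_(i <- s) ((y i)%:P + u i *: 'X))`_1 =
  \sum_(j <- s) u j * \prod_(i <- s | i != j) y i.
Proof.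
elim: s => [|x s IH]; first by rewrite !big_nil coefC.
rewrite cons_uniq => /andP[xs us]; rewrite !big_cons coefM !big_ord_recl big_ord0 /= addr0.
rewrite eqxx /= subn0 /bump /= addn0 subnn IH // coef0_prod.
rewrite !coefD !coefC !coefZ !coefX /= mulr0 mulr1 addr0 add0r addrC; congr (_ + _).
  congr (_ * _); rewrite big_seq [RHS]big_seq_cond; apply: eq_big => [i|i _].
    by case: eqP => [->|]; rewrite ?(negPf xs) //= andbT.
  by rewrite coefD coefC coefZ coefX /= mulr0 addr0.
rewrite mulr_sumr !big_seq; apply: eq_bigr => j js; rewrite big_cons.
have -> : x != j by apply: contraNneq xs => ->.
by rewrite mulrCA.
Qed.

End CauchyEstimate.

(** * Tetrahedral polynomials indexed by supports, and their gradient estimate *)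

Section SetPolynomial.
Variables (R : realType) (T : finType).
Local Notation C := R[i].
Implicit Types (f : {set T} -> C) (y z u v : T -> C) (A : {set T}).

(** A tetrahedral monomial is determined by its support, so coefficients are indexed by the subsets
    of the variables. *)
Definition set_poly f z : C := \sum_A f A * \prod_(i in A) z i.

(** The coefficients of the partial derivative in the variable [j]. *)
Definition set_deriv (j : T) f A : C := if j \in A then 0 else f (j |: A).

Lemma sum_set_mem (V : nmodType) (j : T) (h : {set T} -> V) :
  \sum_(A : {set T} | j \in A) h A = \sum_(A : {set T} | j \notin A) h (j |: A).
Proof.
rewrite (reindex_onto (fun A => j |: A) (fun A => A :\ j)) /=; last first.
  by move=> A jA; rewrite finset.setD1K.
apply: eq_bigl => A; rewrite !inE eqxx /=; apply/eqP/idP => [<-|jA].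
  by rewrite !inE eqxx.
by rewrite finset.setU1K.
Qed.

(** The directional derivative at [y] along [u] is the linear coefficient in t of the polynomial at
    y + t u, to which the Cauchy estimate on the unit circle applies. *)
Lemma set_poly_direction f y u (M : R) :
  (forall t, cabs t = 1 -> cabs (set_poly f (fun i => y i + t * u i)) <= M) ->
  cabs (\sum_j u j * set_poly (set_deriv j f) y) <= M.
Proof.
move=> fM; pose p : {poly C} := \sum_A f A *: \prod_(i in A) ((y i)%:P + u i *: 'X).
have -> : \sum_j u j * set_poly (set_deriv j f) y = p`_1; last first.
  apply: coef1_le_circle => t /fM; rewrite /set_poly /p horner_sum.
  congr (cabs _ <= M); apply: eq_bigr => A _; rewrite hornerZ horner_prod.
  by congr (_ * _); apply: eq_bigr => i _; rewrite !hornerE mulrC.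
rewrite /p coef_sum; under [RHS]eq_bigr => A _.
  rewrite coefZ -big_enum coef1_prod_affine ?enum_uniq // big_enum /= mulr_sumr.
  under eq_bigr do rewrite big_enum_cond.
  over.
rewrite (exchange_big_dep xpredT) //=; apply: eq_bigr => j _.
rewrite sum_set_mem /set_poly mulr_sumr (bigID (fun A : {set T} => j \in A)) /=.
rewrite big1 ?add0r => [|A jA]; last by rewrite /set_deriv jA mul0r mulr0.
apply: eq_bigr => A jA; rewrite /set_deriv (negPf jA) mulrCA; congr (_ * (_ * _)).
apply: eq_bigl => i.
by rewrite !inE; case: eqP => [->|]; rewrite ?(negPf jA) ?andbF ?andbT.
Qed.

(** Multiplying the entries of [v] by phases makes all terms of the directional derivative
    nonnegative. The hypothesis is on moduli only, so it covers every choice of phases. *)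
Lemma set_poly_gradient f y v (M : R) :
  (forall x, (forall i, cabs (x i) <= cabs (y i) + cabs (v i)) -> cabs (set_poly f x) <= M) ->
  \sum_j cabs (v j) * cabs (set_poly (set_deriv j f) y) <= M.
Proof.
move=> fM; have [ph phP] := choice (fun j => cabs_phase (v j * set_poly (set_deriv j f) y)).
have -> : \sum_j cabs (v j) * cabs (set_poly (set_deriv j f) y) =
    cabs (\sum_j (ph j * v j) * set_poly (set_deriv j f) y).
  under [in RHS]eq_bigr do rewrite -mulrA (phP _).2.
  rewrite -rmorph_sum cabs_real ger0_norm; last by apply: sumr_ge0 => j _; exact: cabs_ge0.
  by apply: eq_bigr => j _; rewrite cabsM.
apply: set_poly_direction => t t1; apply: fM => i.
by apply: le_trans (cabsD _ _) _; rewrite !cabsM t1 (phP i).1 !mul1r.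
Qed.

(** A nonempty set [A] is counted on the right once for each of its elements, hence at least
    once. *)
Lemma set_poly_abs_split f z :
  \sum_A cabs (f A) * \prod_(i in A) cabs (z i) <=
  cabs (f finset.set0) + \sum_j cabs (z j) * \sum_A cabs (set_deriv j f A) * \prod_(i in A) cabs (z i).
Proof.
rewrite (bigD1 finset.set0) //= big_set0 mulr1 lerD2l.
pose F A := cabs (f A) * \prod_(i in A) cabs (z i).
have F0 A : 0 <= F A by rewrite mulr_ge0 ?cabs_ge0 ?prodr_ge0 // => i _; exact: cabs_ge0.
apply: (@le_trans _ _ (\sum_j \sum_(A : {set T} | j \in A) F A)).
  rewrite (exchange_big_dep xpredT) //= [leRHS](bigD1 finset.set0) //= -[leLHS]add0r lerD //.
    by apply: sumr_ge0 => j _.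
  apply: ler_sum => A /set0Pn[j jA]; rewrite [leRHS](bigD1 j) //= lerDl.
  by apply: sumr_ge0.
apply: ler_sum => j _; rewrite sum_set_mem mulr_sumr [leRHS](bigID (fun A : {set T} => j \in A)) /=.
rewrite [X in X + _]big1 ?add0r => [|A jA]; last by rewrite /set_deriv jA cabs0 mul0r mulr0.
apply: ler_sum => A jA; rewrite /F big_setU1 //= /set_deriv (negPf jA).
by rewrite mulrCA.
Qed.

Lemma set_deriv_degree j f m : (forall A, (m < #|A|)%N -> f A = 0) ->
  forall A, (m.-1 < #|A|)%N -> set_deriv j f A = 0.
Proof.
move=> fm A mA; rewrite /set_deriv; case: ifPn => // jA; apply: fm.
by rewrite cardsU1 jA add1n; move: mA; clear; case: m.
Qed.

Lemma set_poly0 f : set_poly f (fun=> 0) = f finset.set0.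
Proof.
rewrite /set_poly (bigD1 finset.set0) //= big_set0 mulr1 big1 ?addr0 // => A /set0Pn[j jA].
by rewrite (bigD1 j) //= mul0r mulr0.
Qed.

Lemma set_poly_walsh f (x : T -> C) (w : {ffun T -> bool}) :
  set_poly f (fun i => x i * (-1) ^+ (w i)) =
  \sum_A (f A * \prod_(i in A) x i) * walsh R A w.
Proof. by apply: eq_bigr => A _; rewrite big_split mulrA. Qed.

End SetPolynomial.

(** * Passage from multi-indices to supports *)

Section Tetrahedral.
Variables (R : realType) (n : nat) (J : {fset multi_index n}).
Local Notation C := R[i].
Hypothesis Jt : tetrahedral J.

Definition mi_supp (a : multi_index n) : {set 'I_n} := [set i | tnth a i != 0%N].

Lemma tetrahedral_tnth (a : J) i : tnth (fsval a) i = (i \in mi_supp (fsval a)).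
Proof.
rewrite inE; have /allP/(_ (tnth (fsval a) i) (mem_tnth _ _)) := Jt (fsvalP a).
by case: (tnth _ i) => [|[|]].
Qed.

Lemma mi_supp_inj (a b : J) : mi_supp (fsval a) = mi_supp (fsval b) -> a = b.
Proof.
move=> ab; apply/val_inj/eq_from_tnth => i.
by rewrite /= !tetrahedral_tnth ab.
Qed.

Lemma mon_supp (a : J) (z : 'I_n -> C) :
  mon (fsval a) z = \prod_(i in mi_supp (fsval a)) z i.
Proof.
rewrite /mon [RHS]big_mkcond; apply: eq_bigr => i _; rewrite tetrahedral_tnth.
by case: (i \in _).
Qed.

Lemma card_mi_supp (a : J) : #|mi_supp (fsval a)| = (\sum_(i < n) tnth (fsval a) i)%N.
Proof.
by rewrite -sum1_card big_mkcond; apply: eq_bigr => i _; rewrite tetrahedral_tnth; case: (_ \in _).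
Qed.

(** For tetrahedral [J] at most one index has support [A], so this is the extension of [c] by zero
    to all sets. *)
Definition set_coef (c : J -> C) (A : {set 'I_n}) : C :=
  \sum_(a : J | mi_supp (fsval a) == A) c a.

Lemma set_coef_supp c (a : J) : set_coef c (mi_supp (fsval a)) = c a.
Proof.
rewrite /set_coef (big_pred1 a) // => b.
by apply/eqP/eqP => [/mi_supp_inj|->].
Qed.

Lemma poly_eval_set_poly c z : poly_eval c z = set_poly (set_coef c) z.
Proof.
rewrite /set_poly; under eq_bigr do rewrite mulr_suml.
rewrite (exchange_big_dep xpredT) //=; apply: eq_bigr => a _.
rewrite (big_pred1 (mi_supp (fsval a))) => [|A]; last by rewrite /= eq_sym.
by rewrite mon_supp.
Qed.

Lemma set_coef_degree c m : deg_at_most J m ->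
  forall A : {set 'I_n}, (m < #|A|)%N -> set_coef c A = 0.
Proof.
move=> Jm A mA; apply: big1 => a /eqP aA; exfalso.
by have := Jm _ (fsvalP a); rewrite -card_mi_supp aA leqNgt mA.
Qed.

Lemma sum_supp_le (h : {set 'I_n} -> R) : (forall A, 0 <= h A) ->
  \sum_(a : J) h (mi_supp (fsval a)) <= \sum_A h A.
Proof.
move=> h0; have -> : \sum_(a : J) h (mi_supp (fsval a)) =
    \sum_A \sum_(a : J | mi_supp (fsval a) == A) h A.
  rewrite (exchange_big_dep xpredT) //=; apply: eq_bigr => a _.
  by rewrite (big_pred1 (mi_supp (fsval a))) => [//|A]; rewrite /= eq_sym.
apply: ler_sum => A _; have [[a aA]|na] := pselect (exists a : J, mi_supp (fsval a) = A).
  rewrite (big_pred1 a) // => b.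
  by rewrite -aA; apply/eqP/eqP => [/mi_supp_inj|->].
by rewrite big1 // => a /eqP aA; case: na; exists a.
Qed.

End Tetrahedral.

(** * Estimates for sums of powers *)

Section PowerSums.
Variable R : realType.

Lemma powR_le_mono (a x y : R) : 0 <= a -> 0 <= x -> x <= y -> x `^ a <= y `^ a.
Proof. by move=> a0 x0 xy; apply: ge0_ler_powR => //; rewrite nnegrE // (le_trans x0). Qed.

(** Bernoulli's inequality for the integer exponent [N], after (1 - x)^q >= (1 - x)^N. *)
Lemma powR_one_sub_ge (x q : R) (N : nat) : 0 <= x -> x <= 1 -> 0 < q -> q <= N%:R ->
  1 - N%:R * x <= (1 - x) `^ q.
Proof.
move=> x0 x1 q0 qN; have [e|xn1] := eqVneq x 1.
  rewrite e subrr mulr1 powR0 ?gt_eqF // subr_le0 ler1n.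
  by case: N qN => //; rewrite leNgt q0.
have y0 : 0 < 1 - x by rewrite subr_gt0 lt_neqAle xn1.
apply: (@le_trans _ _ ((1 - x) ^+ N)).
  elim: {q q0 qN} N => [|N IH]; first by rewrite expr0 mul0r subr0.
  rewrite exprS; apply: (@le_trans _ _ ((1 - x) * (1 - N%:R * x))); last first.
    by rewrite ler_wpM2l // ltW.
  rewrite -natr1; have : 0 <= N%:R * x * x by rewrite !mulr_ge0.
  by lra.
have y1 : 0 < 1 - x <= 1 by rewrite y0 /= lerBlDr lerDl.
by rewrite -powR_mulrn ?(ltW y0) //; exact: (ger_powR y1).
Qed.

(** The chain is (1 - x)^q <= exp(-q x) <= 1 / (1 + q x), and the last comparison uses x <= 1. *)
Lemma powR_one_sub_le (x q : R) : 0 <= x -> x <= 1 -> 0 < q ->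
  (1 - x) `^ q <= 1 - q / (1 + q) * x.
Proof.
move=> x0 x1 q0; have y0 : 0 <= 1 - x by rewrite subr_ge0.
have qx0 : 0 <= q * x by rewrite mulr_ge0 // ltW.
have qx1 : 0 < 1 + q * x by rewrite ltr_wpDr.
have q1 : 0 < 1 + q by rewrite addr_gt0.
apply: (@le_trans _ _ (1 + q * x)^-1).
  apply: (@le_trans _ _ (expR (- x) `^ q)).
    by apply: powR_le_mono => //; [exact: ltW | exact: expR_ge1Dx].
  rewrite /powR gt_eqF ?expR_gt0 // expRK mulrN expRN lef_pV2 ?posrE ?expR_gt0 //.
  exact: expR_ge1Dx.
rewrite -[leLHS]mul1r ler_pdivrMr //.
have -> : (1 - q / (1 + q) * x) * (1 + q * x) = 1 + q ^+ 2 * x * (1 - x) / (1 + q).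
  by field; rewrite gt_eqF.
by rewrite lerDl divr_ge0 ?mulr_ge0 ?exprn_ge0 // ltW.
Qed.

Lemma powR_pred (l : nat) (q : R) :
  (l%:R : R) `^ q = l.+1%:R `^ q * (1 - l.+1%:R^-1) `^ q.
Proof.
rewrite -powRM // ?subr_ge0 ?invf_le1 ?ler1n ?ltr0n //.
by rewrite mulrBr mulr1 divff ?pnatr_eq0 // -natr1 addrK.
Qed.

(** A discrete version of integrating t^(q-1), valid for either sign of q - 1: the increments of k^q
    are compared with the summands through Bernoulli's inequality. *)
Lemma sum_powR_ge (q : R) (N k : nat) : 0 < q -> q <= N%:R ->
  (k%:R : R) `^ q <= N%:R * \sum_(1 <= l < k.+1) (l%:R : R) `^ (q - 1).
Proof.
move=> q0 qN; elim: k => [|k IH]; first by rewrite powR0 ?gt_eqF // big_geq // mulr0.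
rewrite big_nat_recr //= mulrDr -lerBlDr.
apply: le_trans IH; rewrite (powR_pred k).
have k0 : (0 : R) < k.+1%:R by rewrite ltr0n.
have -> : (k.+1%:R : R) `^ (q - 1) = k.+1%:R `^ q * k.+1%:R^-1.
  by rewrite powRB ?(gt_eqF k0) ?implybT // powRr1 // ltW.
rewrite mulrCA -[X in X - _ <= _]mulr1 -mulrBr ler_wpM2l ?powR_ge0 //.
by apply: powR_one_sub_ge; rewrite // invf_le1 // ler1n.
Qed.

Lemma sum_powR_le (q : R) (k : nat) : 0 < q ->
  \sum_(1 <= l < k.+1) (l%:R : R) `^ (q - 1) <= (1 + q) / q * k%:R `^ q.
Proof.
move=> q0; have q1 : 0 < 1 + q by rewrite addr_gt0.
suff : q / (1 + q) * \sum_(1 <= l < k.+1) (l%:R : R) `^ (q - 1) <= k%:R `^ q.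
  by rewrite -ler_pdivlMl ?divr_gt0 // invf_div.
elim: k => [|k IH]; first by rewrite powR0 ?gt_eqF // big_geq // mulr0.
rewrite big_nat_recr //= mulrDr; apply: le_trans (lerD IH (lexx _)) _.
have k0 : (0 : R) < k.+1%:R by rewrite ltr0n.
rewrite (powR_pred k); have -> : (k.+1%:R : R) `^ (q - 1) = k.+1%:R `^ q * k.+1%:R^-1.
  by rewrite powRB ?(gt_eqF k0) ?implybT // powRr1 // ltW.
rewrite mulrCA -mulrDr -[leRHS]mulr1 ler_wpM2l ?powR_ge0 // -lerBrDr.
by apply: powR_one_sub_le; rewrite // invf_le1 // ler1n.
Qed.

Lemma powR_double_le (q : R) (k l : nat) : 0 <= q -> (0 < l)%N -> (l <= k)%N -> (k <= l.*2)%N ->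
  (k%:R : R) `^ (q - 1) <= 2 `^ q * l%:R `^ (q - 1).
Proof.
move=> q0 l0 lk kl.
have l0' : (0 : R) < l%:R by rewrite ltr0n.
have k0' : (0 : R) < k%:R by rewrite ltr0n (leq_trans l0).
rewrite !powRB ?(gt_eqF l0') ?(gt_eqF k0') ?implybT // !powRr1 ?ler0n // mulrA -powRM //.
apply: ler_pM; rewrite ?powR_ge0 ?invr_ge0 ?ler0n //; last by rewrite lef_pV2 ?posrE ?ler_nat.
by apply: powR_le_mono; rewrite ?ler0n // -natrM ler_nat mul2n.
Qed.

(** Each l >= 1 equals [uphalf k] for exactly two values of k, namely 2l - 1 and 2l, and for both
    k^(q-1) <= 2^q l^(q-1). *)
Lemma sum_uphalf_le (q : R) (g : nat -> R) (n : nat) : 0 <= q -> (forall l, 0 <= g l) ->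
  \sum_(1 <= k < n.+1) g (uphalf k) * k%:R `^ (q - 1) <=
  2 * 2 `^ q * \sum_(1 <= l < n.+1) g l * l%:R `^ (q - 1).
Proof.
move=> q0 g0; pose G k : R := g (uphalf k) * k%:R `^ (q - 1).
have G0 k : 0 <= G k by rewrite mulr_ge0 ?powR_ge0.
(* The range is enlarged so that both preimages of every l <= n are present. *)
apply: (@le_trans _ _ (\sum_(1 <= k < n.*2.+1) G k)).
  rewrite [leRHS](@big_cat_nat _ _ _ n.+1) //=; last by rewrite ltnS -addnn leq_addr.
  by rewrite lerDl sumr_ge0.
rewrite mulr_sumr; elim: n => [|n IH]; first by rewrite !big_geq.
rewrite doubleS (big_nat_recr n.*2.+2) // (big_nat_recr n.*2.+1) // (big_nat_recr n.+1) //=.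
rewrite -addrA lerD // /G /= uphalf_double doubleK.
have h k : (n.+1 <= k)%N -> (k <= n.+1.*2)%N ->
    g n.+1 * k%:R `^ (q - 1) <= g n.+1 * (2 `^ q * n.+1%:R `^ (q - 1)).
  by move=> h1 h2; rewrite ler_wpM2l // powR_double_le.
apply: (@le_trans _ _ (g n.+1 * (2 `^ q * n.+1%:R `^ (q - 1)) + g n.+1 * (2 `^ q * n.+1%:R `^ (q - 1)))).
  by apply: lerD; apply: h; lia.
by rewrite le_eqVlt; apply/orP; left; apply/eqP; ring.
Qed.

End PowerSums.

(** * The decreasing rearrangement *)

Section Rearrangement.
Variable R : realType.
Local Notation C := R[i].

(** Describes the rearrangement by the distribution function; [0 <= t] covers the default value 0
    past the end of the list. *)
Lemma nth_sorted_le (s : seq R) (t : R) k : 0 <= t -> sorted (fun x y => y <= x) s ->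
  (nth 0 s k <= t) = (count (fun x => (t < x)%R) s <= k)%N.
Proof.
move=> t0; elim: s k => [|x s IH] k; first by rewrite nth_nil t0.
move=> /= xs; have ss := path_sorted xs.
have [xt|tx] := leP x t; last by case: k => [|k] /=; rewrite ?IH // leNgt tx.
have c0 : count (fun x => t < x) s = 0%N.
  apply/eqP; rewrite -leqn0 leqNgt -has_count; apply/hasPn => y ys; rewrite -leNgt.
  apply: le_trans xt; have tr : transitive (fun x y : R => y <= x).
    by move=> a b c ba ac; exact: le_trans ac ba.
  by have /allP/(_ y ys) := order_path_min tr xs.
case: k => [|k] /=; first by rewrite c0 xt.
by rewrite IH // c0.
Qed.

Variable n : nat.
Implicit Types (z v y : 'I_n -> C) (k : nat).

Lemma zstar_le z k (t : R) : (0 < k)%N -> 0 <= t ->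
  (zstar z k <= t) = (#|[set i | (t < cabs (z i))%R]%SET| < k)%N.
Proof.
case: k => // k _ t0; rewrite /zstar nth_sorted_le //=; last first.
  by apply: sort_sorted => x y; exact: le_total.
rewrite ltnS; congr (_ <= _)%N.
rewrite /decr_rearr (permP (permEl (perm_sort _ _))) count_map -size_filter cardE.
congr size; rewrite enumT; apply: eq_filter => i; symmetry.
exact: finset.in_set.
Qed.

Lemma sum_zstar z (phi : R -> R) :
  \sum_i phi (cabs (z i)) = \sum_(1 <= k < n.+1) phi (zstar z k).
Proof.
have sz : size (decr_rearr z) = n by rewrite size_sort size_map size_enum_ord.
rewrite big_add1 /=; transitivity (\sum_(x <- decr_rearr z) phi x).
  by rewrite (perm_big _ (permEl (perm_sort _ _))) big_map big_enum.
by rewrite (big_nth 0) sz.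
Qed.

Lemma zstar_ge0 z k : 0 <= zstar z k.
Proof.
rewrite /zstar; have [lt|ge] := ltnP k.-1 (size (decr_rearr z)); last by rewrite nth_default.
have := mem_nth 0 lt; rewrite mem_sort => /mapP[i _ ->]; exact: cabs_ge0.
Qed.

Lemma zstar_anti z k l : (0 < l)%N -> (l <= k)%N -> zstar z k <= zstar z l.
Proof.
move=> l0 lk; rewrite zstar_le ?zstar_ge0 ?(leq_trans l0) //.
by apply: leq_trans lk; rewrite -zstar_le ?zstar_ge0.
Qed.

(** Where |v_i| > 2t, either |y_i| > t or d |z_i| > t. Each of the two happens for fewer than
    [uphalf k] indices, so together they cover at most 2 (uphalf k - 1) < k indices. *)
Lemma zstar_half (v y z : 'I_n -> C) (d : R) k : (0 < k)%N -> 0 < d ->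
  (forall i, cabs (v i) <= cabs (y i) + d * cabs (z i)) ->
  zstar v k <= 2 * Num.max (zstar y (uphalf k)) (d * zstar z (uphalf k)).
Proof.
move=> k0 d0 vyz; set t := Num.max _ _.
have h0 : (0 < uphalf k)%N by case: k k0 {t}.
have t0 : 0 <= t by rewrite le_max zstar_ge0.
rewrite zstar_le ?mulr_ge0 //.
have : (#|[set i | (t < cabs (y i))%R]%SET| < uphalf k)%N by rewrite -zstar_le // le_max lexx.
have : (#|[set i | (t / d < cabs (z i))%R]%SET| < uphalf k)%N.
  rewrite -zstar_le //; last by rewrite divr_ge0 // ltW.
  by rewrite ler_pdivlMr // mulrC le_max lexx orbT.
have : (#|[set i | (2 * t < cabs (v i))%R]%SET| <=
  #|[set i | (t < cabs (y i))%R]%SET| + #|[set i | (t / d < cabs (z i))%R]%SET|)%N.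
  apply: leq_trans (leq_card_setU _ _); apply: subset_leq_card.
  apply/fintype.subsetP => i; rewrite !inE => h.
  apply/orP; have [yt|] := leP (cabs (y i)) t; last by left.
  right; rewrite ltr_pdivrMr // mulrC.
  by have := vyz i; lra.
have : ((uphalf k).*2 <= k.+1)%N by rewrite uphalf_half -[in k.+1](odd_double_half k); lia.
move: #|_| #|_| #|_| (uphalf k) => a b c h; lia.
Qed.

Lemma zstar_flat y (B : {set 'I_n}) (a : R) k : (0 < k)%N -> 0 <= a ->
  (forall i, i \in B -> cabs (y i) <= a) -> (forall i, i \notin B -> y i = 0) ->
  zstar y k <= (if (k <= #|B|)%N then a else 0).
Proof.
move=> k0 a0 yB y0; case: ifPn => [_|kB]; rewrite zstar_le //.
  rewrite (_ : [set _ | _]%SET = finset.set0) ?cards0 //; apply/finset.setP => i.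
  rewrite !inE; apply/negbTE; rewrite -leNgt.
  by have [/yB//|/y0->] := boolP (i \in B); rewrite cabs0.
rewrite -ltnNge in kB; apply: leq_ltn_trans kB; apply: subset_leq_card.
apply/fintype.subsetP => i; rewrite !inE; apply: contraTT => /y0 ->.
by rewrite cabs0 ltxx.
Qed.

End Rearrangement.

(** * Unit balls of Lorentz spaces *)

Section LorentzBall.
Variables (R : realType) (r : R).
Hypothesis r1 : 1 < r.
Local Notation C := R[i].

Let r0 : 0 < r. Proof. exact: lt_trans ltr01 r1. Qed.
Let rV0 : 0 <= r^-1. Proof. by rewrite invr_ge0 ltW. Qed.

Lemma lorentz_fin_lt1 (s : R) n (z : 'I_n -> C) : 1 <= s ->
  (lorentz_norm r s%:E z < 1) =
  (\sum_(1 <= k < n.+1) zstar z k `^ s * k%:R `^ (s / r - 1) < 1).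
Proof.
move=> s1; have s0 : 0 < s by exact: lt_le_trans ltr01 s1.
rewrite /lorentz_norm; set S := \sum_(1 <= k < n.+1) _.
have -> : \sum_(1 <= k < n.+1) zstar z k `^ s * k%:R `^ (s / r - 1) = S.
  apply: eq_bigr => k _; rewrite powRM ?zstar_ge0 ?powR_ge0 // -powRrM.
  by congr (_ * _ `^ _); field; rewrite !gt_eqF.
have S0 : 0 <= S by apply: sumr_ge0 => k _; exact: powR_ge0.
have sV0 : 0 < s^-1 by rewrite invr_gt0.
apply/idP/idP => [|S1]; last first.
  rewrite -[ltRHS](_ : 1 `^ s^-1 = 1); last by rewrite powR1.
  by apply: gt0_ltr_powR; rewrite ?nnegrE.
apply: contraTT; rewrite -!leNgt => S1.
rewrite -[leLHS](_ : 1 `^ s^-1 = 1); last by rewrite powR1.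
by apply: powR_le_mono => //; exact: ltW.
Qed.

Lemma lorentz_pinfty_lt1 n (z : 'I_n -> C) :
  lorentz_norm r +oo%E z < 1 <->
  forall k, (1 <= k < n.+1)%N -> zstar z k * k%:R `^ r^-1 < 1.
Proof.
split=> [h k kn|h].
  apply: le_lt_trans h.
  apply: (@le_bigmax_seq _ _ _ _ _ k xpredT (fun k => zstar z k * k%:R `^ r^-1)) => //.
  by rewrite mem_index_iota.
rewrite /lorentz_norm big_nat; elim/big_ind: _ => // x y x1 y1.
by rewrite gt_max x1.
Qed.

Variable s : \bar R.
Hypothesis s1 : (1 <= s)%E.

Lemma lorentz0_lt1 n : lorentz_norm r s (fun _ : 'I_n => 0) < 1.
Proof.
have z0 k : (0 < k)%N -> zstar (fun _ : 'I_n => 0 : C) k = 0.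
  move=> k0; apply/eqP; rewrite eq_le zstar_ge0 andbT zstar_le //.
  rewrite (_ : [set _ | _]%SET = finset.set0) ?cards0 //; apply/finset.setP => i.
  by rewrite !inE cabs0 ltxx.
case: s s1 => [s'| |] // h1.
  have s'1 : 1 <= s' by [].
  rewrite lorentz_fin_lt1 // big_nat big1 // => k /andP[k0 _].
  by rewrite z0 // powR0 ?mul0r // gt_eqF // (lt_le_trans ltr01).
by apply/lorentz_pinfty_lt1 => k /andP[k0 _]; rewrite z0 // mul0r.
Qed.

(** The inclusion of l_(r,s) in weak l_r. For finite [s], monotonicity of the rearrangement bounds
    its k-th entry to the power s, times the sum of l^(s/r-1) over l <= k, by 1; that sum is at
    least k^(s/r) / N. *)
Lemma lorentz_weak_bound : exists N : R, 1 <= N /\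
  forall n (z : 'I_n -> C) k, lorentz_norm r s z < 1 -> (1 <= k < n.+1)%N ->
  zstar z k <= N * k%:R `^ (- r^-1).
Proof.
case: s s1 => [s'| |] // h1; last first.
  exists 1; split=> // n z k /lorentz_pinfty_lt1 h kn; rewrite mul1r powRN.
  have k0 : (0 : R) < k%:R by rewrite ltr0n; case/andP: kn.
  by rewrite -[leRHS]mul1r ler_pdivlMr ?powR_gt0 //; exact/ltW/h.
have s'1 : 1 <= s' by [].
have s0 : 0 < s' by exact: lt_le_trans ltr01 s'1.
have q0 : 0 < s' / r by rewrite divr_gt0.
(* An integer above s'/r, as [sum_powR_ge] requires. It also serves as the constant, because N <=
   N^s' for s' >= 1. *)
have := archi_boundP (ltW q0); set N := Num.bound _ => qN.
have N1 : 1 <= N%:R :> R by rewrite ler1n; case: (N) qN => //; rewrite ltNge (ltW q0).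
exists N%:R; split => // n z k zb /andP[k0 kn].
have k0' : (0 : R) < k%:R by rewrite ltr0n.
rewrite powRN ler_pdivlMr ?powR_gt0 //.
have pos : 0 <= zstar z k * k%:R `^ r^-1 by rewrite mulr_ge0 ?zstar_ge0 ?powR_ge0.
suff h : (zstar z k * k%:R `^ r^-1) `^ s' <= N%:R `^ s'.
  rewrite leNgt; apply/negP => lt; have := gt0_ltr_powR s0 _ _ lt.
  by rewrite ltNge h !nnegrE ler0n => /(_ isT pos).
apply: (@le_trans _ _ N%:R); last by exact: le1r_powR.
rewrite powRM ?zstar_ge0 ?powR_ge0 // -powRrM mulrC (mulrC r^-1).
apply: (@le_trans _ _ (zstar z k `^ s' * (N%:R * \sum_(1 <= l < k.+1) (l%:R : R) `^ (s' / r - 1)))).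
  by rewrite mulrC ler_wpM2l ?powR_ge0 // sum_powR_ge // ltW.
rewrite mulrCA -[leRHS]mulr1 ler_wpM2l //.
move: zb; rewrite lorentz_fin_lt1 // => /ltW; apply: le_trans.
rewrite mulr_sumr [leRHS](@big_cat_nat _ _ _ k.+1) //=.
apply: (@le_trans _ _ (\sum_(1 <= l < k.+1) zstar z l `^ s' * l%:R `^ (s' / r - 1))); last first.
  by rewrite lerDl sumr_ge0 // => l _; rewrite mulr_ge0 ?powR_ge0.
rewrite !big_nat; apply: ler_sum => l /andP[l0 lk]; rewrite ler_wpM2r ?powR_ge0 //.
by apply: powR_le_mono; rewrite ?zstar_ge0 ?(ltW s0) // zstar_anti.
Qed.

(** The weak bound reduces this to the sum of k^(-p/r), whose exponent is above -1 because p < r. It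
    is applied with p = 1 and p = 2. *)
Lemma lorentz_power_sum (p : nat) : (0 < p)%N -> p%:R < r -> exists K : R, 0 < K /\
  forall n (z : 'I_n -> C), lorentz_norm r s z < 1 ->
  \sum_i cabs (z i) ^+ p <= K * n%:R `^ (1 - p%:R / r).
Proof.
move=> p0 pr; have [N [N1 Nb]] := lorentz_weak_bound.
have N0 : 0 < N by exact: lt_le_trans ltr01 N1.
set q := 1 - p%:R / r; have q0 : 0 < q by rewrite subr_gt0 ltr_pdivrMr // mul1r.
exists (N ^+ p * ((1 + q) / q)); split.
  apply: mulr_gt0; first exact: exprn_gt0.
  by apply: divr_gt0 => //; apply: addr_gt0.
move=> n z zb; rewrite (sum_zstar z (fun x => x ^+ p)) -mulrA.
apply: le_trans (ler_wpM2l (exprn_ge0 _ (ltW N0)) (sum_powR_le n q0)).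
rewrite mulr_sumr !big_nat; apply: ler_sum => k kn.
apply: (@le_trans _ _ ((N * k%:R `^ (- r^-1)) ^+ p)).
  by apply: lerXn2r; rewrite ?nnegrE ?zstar_ge0 ?mulr_ge0 ?powR_ge0 ?(ltW N0) //; exact: Nb.
rewrite exprMn ler_wpM2l ?exprn_ge0 ?(ltW N0) // -powR_mulrn ?powR_ge0 // -powRrM.
by rewrite /q addrC addKr mulNr mulrC.
Qed.

(** A substitute for the triangle inequality, as the Lorentz norm may be only a quasi-norm. It is
    stated through moduli, so that y and d z can be added with arbitrary phases. *)
Definition absorbs (d : R) := forall n (v y z : 'I_n -> C) (B : {set 'I_n}) j,
  lorentz_norm r s z < 1 -> (0 < j)%N -> (j <= n)%N -> (#|B| <= j)%N ->
  (forall i, i \in B -> cabs (y i) <= d * j%:R `^ (- r^-1)) ->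
  (forall i, i \notin B -> y i = 0) ->
  (forall i, cabs (v i) <= cabs (y i) + d * cabs (z i)) ->
  lorentz_norm r s v < 1.

Lemma zstar_flat_power n (y : 'I_n -> C) (B : {set 'I_n}) (d : R) j k :
  0 <= d -> (0 < k)%N -> (#|B| <= j)%N ->
  (forall i, i \in B -> cabs (y i) <= d * j%:R `^ (- r^-1)) ->
  (forall i, i \notin B -> y i = 0) ->
  zstar y k <= (if (k <= j)%N then d * j%:R `^ (- r^-1) else 0).
Proof.
move=> d0 k0 Bj yB y0.
have a0 : 0 <= d * j%:R `^ (- r^-1) by rewrite mulr_ge0 ?powR_ge0.
apply: le_trans (zstar_flat k0 a0 yB y0) _.
by case: ifP => kB; case: ifP => // kj; rewrite (leq_trans kB Bj) in kj.
Qed.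

Lemma zstar_half_max (n : nat) (v y z : 'I_n -> C) (d a : R) k : 0 < d -> (0 < k)%N ->
  (forall i, cabs (v i) <= cabs (y i) + d * cabs (z i)) ->
  zstar y (uphalf k) <= a ->
  zstar v k <= 2 * Num.max a (d * zstar z (uphalf k)).
Proof.
move=> d0 k0 vyz ya; apply: le_trans (zstar_half k0 d0 vyz) _.
rewrite ler_wpM2l // ge_max !le_max lexx orbT andbT.
by rewrite ya.
Qed.

(** With q = t/r: a vector of height d j^(-1/r) on j coordinates has l_(r,t) norm bounded
    independently of j. *)
Lemma flat_power_sum (q d t : R) (n j : nat) : 0 < q -> 0 < t -> 0 < d -> (0 < j)%N -> (j <= n)%N ->
  \sum_(1 <= l < n.+1) (if (l <= j)%N then d * (j%:R : R) `^ (- (q / t)) else 0) `^ t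
     * l%:R `^ (q - 1) <= d `^ t * ((1 + q) / q).
Proof.
move=> q0 t0 d0 j0 jn.
have j0' : (0 : R) < j%:R by rewrite ltr0n.
rewrite (@big_cat_nat _ _ _ j.+1) //= [X in _ + X <= _]big_nat [X in _ + X <= _]big1 ?addr0; last first.
  by move=> l /andP[jl _]; rewrite leqNgt jl /= powR0 ?gt_eqF // mul0r.
have -> : \sum_(1 <= l < j.+1) (if (l <= j)%N then d * (j%:R : R) `^ (- (q / t)) else 0) `^ t
     * l%:R `^ (q - 1) = d `^ t * (j%:R `^ (- q) * \sum_(1 <= l < j.+1) l%:R `^ (q - 1)).
  rewrite !mulr_sumr !big_nat; apply: eq_bigr => l /andP[_ lj]; rewrite ltnS in lj.
  rewrite lj powRM ?powR_ge0 ?(ltW d0) // -powRrM mulrA; congr (_ * _ `^ _ * _).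
  by field; rewrite gt_eqF.
rewrite ler_wpM2l ?powR_ge0 //.
apply: le_trans (ler_wpM2l (powR_ge0 _ _) (sum_powR_le j q0)) _.
by rewrite mulrCA -powRD ?(gt_eqF j0') ?implybT // addNr powRr0 mulr1.
Qed.

Lemma maxr_powR_le (a b t : R) : 0 <= a -> 0 <= b -> 0 <= t ->
  Num.max a b `^ t <= a `^ t + b `^ t.
Proof.
by move=> a0 b0 t0; case: (leP a b) => _; rewrite ?lerDl ?lerDr powR_ge0.
Qed.

(** The rearrangement of [v] at k is controlled by those of [y] and [z] at [uphalf k]. Returning
    from [uphalf k] to k costs a constant depending on r and s only, which a small [d]
    compensates. *)
Lemma lorentz_flat_perturbation : exists d : R, 0 < d /\ absorbs d.
Proof.
rewrite /absorbs; case: s s1 => [t| |] // h1; last first.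
  (* One factor 2 comes from [zstar_half], another from k^(1/r) <= 2 h^(1/r) with h = uphalf k, and
     4/5 < 1. *)
  exists 5^-1; split; first by rewrite invr_gt0.
  move=> n v y z B j /lorentz_pinfty_lt1 zb j0 jn Bj yB y0 vyz.
  have d0 : (0 : R) < 5^-1 by rewrite invr_gt0.
  apply/lorentz_pinfty_lt1 => k /andP[k0 kn].
  have h0 : (0 < uphalf k)%N by case: k k0 {kn}.
  have hk : (uphalf k <= k)%N by rewrite uphalf_half; have := odd_double_half k; lia.
  have kh : (k <= (uphalf k).*2)%N by rewrite uphalf_half; have := odd_double_half k; lia.
  have yh := zstar_flat_power (ltW d0) h0 Bj yB y0.
  set h := uphalf k in h0 hk kh yh *.
  have h0' : (0 : R) < h%:R by rewrite ltr0n.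
  have j0' : (0 : R) < j%:R by rewrite ltr0n.
  pose W : R := h%:R `^ r^-1.
  have W0 : 0 < W by rewrite powR_gt0.
  have kW : k%:R `^ r^-1 <= 2 * W.
    apply: (@le_trans _ _ ((2 * h%:R) `^ r^-1)).
      by apply: powR_le_mono; rewrite ?ler0n // -natrM ler_nat mul2n.
    rewrite powRM ?ler0n // ler_wpM2r ?(ltW W0) //.
    by apply: ler1_powR; rewrite ?ler1n // invf_le1 // ltW.
  have yW : (if (h <= j)%N then 5^-1 * j%:R `^ (- r^-1) else 0) * W <= 5^-1.
    case: ifP => hj; last by rewrite mul0r ltW.
    rewrite -mulrA -[leRHS]mulr1 ler_wpM2l ?(ltW d0) // powRN mulrC ler_pdivrMr ?powR_gt0 // mul1r.
    by apply: powR_le_mono; rewrite ?ler0n // ler_nat.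
  have zW : 5^-1 * zstar z h * W <= 5^-1.
    rewrite -mulrA -[leRHS]mulr1 ler_wpM2l ?(ltW d0) //; apply/ltW/zb.
    by rewrite h0 /= ltnS (leq_trans hk).
  have vk := zstar_half_max d0 k0 vyz yh.
  apply: (@le_lt_trans _ _ (2 * (2 * (Num.max (if (h <= j)%N then 5^-1 * j%:R `^ (- r^-1) else 0)
     (5^-1 * zstar z h) * W)))).
    apply: le_trans (ler_pM (zstar_ge0 _ _) (powR_ge0 _ _) vk kW) _.
    by rewrite -/h le_eqVlt; apply/orP; left; apply/eqP; ring.
  apply: (@le_lt_trans _ _ (2 * (2 * 5^-1))); last by lra.
  by rewrite !ler_pM2l // maxr_pMl ?(ltW W0) // ge_max yW zW.
have t1 : 1 <= t by [].
have t0 : 0 < t by exact: lt_le_trans ltr01 t1.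
have [q qE] : exists q, q = t / r by eexists.
have q0 : 0 < q by rewrite qE divr_gt0.
(* The factor 2^t comes from [zstar_half] and 2 * 2^q from the reindexing by [uphalf]; the bracket
   adds the contributions of [y] and [z]. For d = 1/M, t >= 1 gives M d^t <= 1. *)
have [M ME] : exists M, M = 2 `^ t * (2 * 2 `^ q) * ((1 + q) / q + 1) by eexists.
have M1 : 1 <= M.
  have a1 : 1 <= 2 `^ t :> R by rewrite -[leLHS](powRr0 2); apply: ler_powR; rewrite ?ler1n // ltW.
  have a2 : 1 <= 2 `^ q :> R by rewrite -[leLHS](powRr0 2); apply: ler_powR; rewrite ?ler1n // ltW.
  have a3 : 0 <= (1 + q) / q by rewrite divr_ge0 ?addr_ge0 // ltW.
  by rewrite ME; apply: mulr_ege1; [apply: mulr_ege1 => //; lra | lra].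
have M0 : 0 < M by exact: lt_le_trans ltr01 M1.
have d0 : 0 < M^-1 by rewrite invr_gt0.
exists M^-1; split; first exact: d0.
move=> n v y z B j zb j0 jn Bj yB y0 vyz.
set d := M^-1 in d0 yB vyz *.
have dt : d `^ t <= d by apply: ge1r_powR => //; rewrite d0 invf_le1.
rewrite (lorentz_fin_lt1 z t1) -qE in zb; rewrite (lorentz_fin_lt1 v t1) -qE.
pose Y l : R := if (l <= j)%N then d * j%:R `^ (- r^-1) else 0.
have Y0 l : 0 <= Y l by rewrite /Y; case: ifP; rewrite ?mulr_ge0 ?powR_ge0 // ltW.
pose g l := 2 `^ t * (Y l `^ t + d `^ t * zstar z l `^ t).
have g0 l : 0 <= g l by rewrite mulr_ge0 ?addr_ge0 ?mulr_ge0 ?powR_ge0.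
apply: (@le_lt_trans _ _ (\sum_(1 <= k < n.+1) g (uphalf k) * k%:R `^ (q - 1))).
  rewrite !big_nat; apply: ler_sum => k /andP[k0 _]; rewrite ler_wpM2r ?powR_ge0 //.
  have h0 : (0 < uphalf k)%N by case: k k0.
  have vk := zstar_half_max d0 k0 vyz (zstar_flat_power (ltW d0) h0 Bj yB y0).
  apply: le_trans (powR_le_mono (ltW t0) (zstar_ge0 _ _) vk) _.
  have dz0 : 0 <= d * zstar z (uphalf k) by rewrite mulr_ge0 ?zstar_ge0 // ltW.
  rewrite powRM ?ler_wpM2l ?powR_ge0 //; last by rewrite le_max dz0 orbT.
  rewrite -powRM ?zstar_ge0 ?(ltW d0) //; apply: maxr_powR_le => //; [exact: Y0|exact: ltW].
apply: le_lt_trans (sum_uphalf_le _ (ltW q0) g0) _.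
have -> : \sum_(1 <= l < n.+1) g l * l%:R `^ (q - 1) =
    2 `^ t * (\sum_(1 <= l < n.+1) Y l `^ t * l%:R `^ (q - 1) +
      d `^ t * \sum_(1 <= l < n.+1) zstar z l `^ t * l%:R `^ (q - 1)).
  rewrite mulr_sumr -big_split mulr_sumr; apply: eq_bigr => l _ /=.
  by rewrite /g; ring.
have Ysum : \sum_(1 <= l < n.+1) Y l `^ t * l%:R `^ (q - 1) <= d `^ t * ((1 + q) / q).
  have := flat_power_sum q0 t0 d0 j0 jn.
  by have -> : q / t = r^-1 by rewrite qE; field; rewrite !gt_eqF.
set Z := \sum_(1 <= l < n.+1) zstar z l `^ t * _ in zb *.
have dt0 : 0 < d `^ t by rewrite powR_gt0.
apply: (@lt_le_trans _ _ (M * d `^ t)); last by rewrite -(divff (lt0r_neq0 M0)) ler_pM2l.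
have -> : M * d `^ t = 2 * 2 `^ q * (2 `^ t * (d `^ t * ((1 + q) / q) + d `^ t)) by rewrite ME; ring.
rewrite ltr_pM2l ?mulr_gt0 ?powR_gt0 // ltr_pM2l ?powR_gt0 //.
(* Strictness comes from [z] alone, whose sum is below 1. *)
by apply: ler_ltD => //; rewrite -[ltRHS]mulr1 ltr_pM2l.
Qed.

End LorentzBall.

(** * Sums over small sets and recovery of coefficients from sign vectors *)

Section LowDegreeSums.
Variables (R : realType) (T : finType).
Local Notation C := R[i].
Implicit Types (a : T -> R) (A : {set T}).

(** The elementary symmetric polynomials of degree at most [d], added up. *)
Definition low_sum (d : nat) a : R := \sum_(A : {set T} | (#|A| <= d)%N) \prod_(i in A) a i.

Lemma low_sum_ge0 d a : (forall i, 0 <= a i) -> 0 <= low_sum d a.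
Proof. by move=> a0; apply: sumr_ge0 => A _; apply: prodr_ge0. Qed.

Lemma sum_prod_set a : \sum_(A : {set T}) \prod_(i in A) a i = \prod_i (1 + a i).
Proof.
under [RHS]eq_bigr do rewrite addrC.
rewrite bigA_distr; apply: eq_bigr => A _.
by rewrite big_mkcond.
Qed.

(* Rankin's trick: charging a factor s > 1 per element removes the constraint
   on the cardinality. *)
Lemma low_sum_rankin d a (s : R) : 1 <= s -> (forall i, 0 <= a i) ->
  low_sum d a <= s ^+ d * expR ((\sum_i a i) / s).
Proof.
move=> s1 a0; have s0 : 0 < s by exact: lt_le_trans ltr01 s1.
have as0 i : 0 <= a i / s by rewrite divr_ge0 // ltW.
apply: (@le_trans _ _ (s ^+ d * \sum_(A : {set T}) \prod_(i in A) (a i / s))).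
  rewrite /low_sum big_mkcond mulr_sumr; apply: ler_sum => A _.
  have p0 : 0 <= \prod_(i in A) (a i / s) by apply: prodr_ge0.
  case: ifP => Ad; last by rewrite mulr_ge0 ?exprn_ge0 // ltW.
  have -> : \prod_(i in A) a i = s ^+ #|A| * \prod_(i in A) (a i / s).
    rewrite -prodr_const -big_split; apply: eq_bigr => i _ /=.
    by rewrite mulrC divfK // gt_eqF.
  by rewrite ler_wpM2r // ler_weXn2l.
rewrite ler_wpM2l ?exprn_ge0 ?(ltW s0) // sum_prod_set mulr_suml.
rewrite expR_sum; apply: ler_prod => i _.
by rewrite addr_ge0 //= expR_ge1Dx.
Qed.

Definition sign_pt (b : T -> R) (w : {ffun T -> bool}) (i : T) : C := (b i)%:C * (-1) ^+ (w i).

Lemma cabs_sign_pt b w i : cabs (sign_pt b w i) = `|b i|.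
Proof. by rewrite /sign_pt mulrC cabs_signM cabs_real. Qed.

Lemma set_poly_sign_pt (f : {set T} -> C) b w :
  set_poly f (sign_pt b w) = \sum_A (f A * (\prod_(i in A) b i)%:C) * walsh R A w.
Proof.
rewrite /sign_pt set_poly_walsh; apply: eq_bigr => A _.
by rewrite rmorph_prod.
Qed.

Lemma set_poly_coef (f : {set T} -> C) b A :
  \sum_w walsh R A w * set_poly f (sign_pt b w) =
  (cube_size R T)%:C * (f A * (\prod_(i in A) b i)%:C).
Proof.
rewrite -(walsh_coef (fun B => f B * (\prod_(i in B) b i)%:C)).
by apply: eq_bigr => w _; rewrite set_poly_sign_pt.
Qed.

Lemma set_poly_coef_le (f : {set T} -> C) b A : (forall i, i \in A -> 0 <= b i) ->
  cabs (f A) * \prod_(i in A) b i <=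
  \sum_w cabs (set_poly f (sign_pt b w)) / cube_size R T.
Proof.
move=> b0; have N0 := cube_size_gt0 R T.
rewrite -mulr_suml ler_pdivlMr //.
have -> : cabs (f A) * \prod_(i in A) b i * cube_size R T =
    cabs (\sum_w walsh R A w * set_poly f (sign_pt b w)).
  rewrite set_poly_coef !cabsM !cabs_real !ger0_norm ?(ltW N0) //; first by rewrite mulrC.
  by apply: prodr_ge0 => i iA; exact: b0.
apply: le_trans (cabs_sum _ _ _) _; apply: ler_sum => w _.
by rewrite cabsM cabs_walsh mul1r.
Qed.

(** Each coefficient is read off at the sign vectors on its own support. These nodes have at most
    [d] nonzero entries, which later permits [x] to be a multiple of m^(-1/r). *)
Lemma abs_sum_le_l1 (g : {set T} -> C) d (x : R) (z : T -> C) : 0 < x ->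
  (forall A, (d < #|A|)%N -> g A = 0) ->
  \sum_A cabs (g A) * \prod_(i in A) cabs (z i) <=
  \sum_(A : {set T} | (#|A| <= d)%N) \sum_w \prod_(i in A) (cabs (z i) / x) / cube_size R T *
    cabs (set_poly g (sign_pt (fun i => if i \in A then x else 0) w)).
Proof.
move=> x0 gd; rewrite [leRHS]big_mkcond; apply: ler_sum => A _.
case: leqP => Ad; last by rewrite gd // cabs0 mul0r.
have P0 : 0 <= \prod_(i in A) (cabs (z i) / x).
  by apply: prodr_ge0 => i _; rewrite divr_ge0 ?cabs_ge0 // ltW.
have -> : \prod_(i in A) cabs (z i) =
    \prod_(i in A) (cabs (z i) / x) * \prod_(i in A) (if i \in A then x else 0).
  rewrite -big_split; apply: eq_bigr => i iA /=; rewrite iA.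
  by rewrite divfK // gt_eqF.
rewrite mulrCA; under [leRHS]eq_bigr do rewrite -mulrA.
rewrite -mulr_sumr ler_wpM2l //; under [leRHS]eq_bigr do rewrite mulrC.
by apply: set_poly_coef_le => i ->; exact: ltW.
Qed.

(** One family of nodes with full support serves all coefficients: Cauchy-Schwarz over the sets,
    then Bonami's comparison. The L^1 form keeps the bound linear in the moduli at the nodes, so
    that it can be summed over the partial derivatives. *)
Lemma abs_sum_le_l2 (g : {set T} -> C) d (x : R) (z : T -> C) : 0 < x ->
  (forall A, (d < #|A|)%N -> g A = 0) ->
  \sum_A cabs (g A) * \prod_(i in A) cabs (z i) <=
  \sum_w 3 ^+ d.+1 * Num.sqrt (low_sum d (fun i => (cabs (z i) / x) ^+ 2)) / cube_size R T *
    cabs (set_poly g (sign_pt (fun=> x) w)).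
Proof.
move=> x0 gd; set L := low_sum _ _.
have L0 : 0 <= L by apply: low_sum_ge0 => i; exact: sqr_ge0.
pose h A := g A * (\prod_(i in A) x)%:C.
have hd A : (d < #|A|)%N -> h A = 0 by move=> dA; rewrite /h gd // mul0r.
have := walsh_l2_le_l1 hd.
have -> : \sum_w cabs (\sum_A h A * walsh R A w) / cube_size R T =
    \sum_w cabs (set_poly g (sign_pt (fun=> x) w)) / cube_size R T.
  by apply: eq_bigr => w _; rewrite set_poly_sign_pt.
set Q := \sum_A cabs (h A) ^+ 2 => hQ.
have Q0 : 0 <= Q by apply: sumr_ge0 => A _; rewrite exprn_ge0 ?cabs_ge0.
apply: (@le_trans _ _ (Num.sqrt Q * Num.sqrt L)); last first.
  apply: le_trans (ler_wpM2r (sqrtr_ge0 _) hQ) _.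
  rewrite mulrAC mulr_sumr le_eqVlt; apply/orP; left; apply/eqP.
  by apply: eq_bigr => w _; rewrite mulrA mulrAC.
pose b A : R := if (#|A| <= d)%N then \prod_(i in A) (cabs (z i) / x) else 0.
have -> : \sum_A cabs (g A) * \prod_(i in A) cabs (z i) = \sum_A cabs (h A) * b A.
  apply: eq_bigr => A _; rewrite /b; case: leqP => Ad; last by rewrite gd // cabs0 mulr0 mul0r.
  rewrite /h cabsM cabs_real ger0_norm; last by apply: prodr_ge0 => i _; exact: ltW.
  rewrite -mulrA -big_split; congr (_ * _); apply: eq_bigr => i _ /=.
  by rewrite mulrC divfK // gt_eqF.
apply: cauchy_schwarz_le; rewrite ?sqrtr_ge0 ?sqr_sqrtr //.
rewrite /L /low_sum [leRHS]big_mkcond; apply: ler_sum => A _; rewrite /b.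
by case: ifP => _; rewrite ?expr0n // prodrXl.
Qed.

(* The product rule reduces the sum over f to its partial derivatives, and the
   gradient estimate at the nodes y i bounds all of them at once; this is what
   lowers the exponent from m to m - 1. *)
Lemma abs_sum_le_nodes (f : {set T} -> C) (m : nat) (z : T -> C) (M : R)
    (I : finType) (P : pred I) (y : I -> T -> C) (mu : I -> R) :
  (forall A, (m < #|A|)%N -> f A = 0) ->
  (forall i, 0 <= mu i) ->
  (forall g : {set T} -> C, (forall A, (m.-1 < #|A|)%N -> g A = 0) ->
     \sum_A cabs (g A) * \prod_(i in A) cabs (z i) <= \sum_(i | P i) mu i * cabs (set_poly g (y i))) ->
  (forall i, P i -> \sum_j cabs (z j) * cabs (set_poly (set_deriv j f) (y i)) <= M) ->
  \sum_A cabs (f A) * \prod_(i in A) cabs (z i) <=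
  cabs (f finset.set0) + (\sum_(i | P i) mu i) * M.
Proof.
move=> fm mu0 nodes grad; apply: le_trans (set_poly_abs_split f z) _; rewrite lerD2l.
apply: (@le_trans _ _ (\sum_j cabs (z j) * \sum_(i | P i) mu i * cabs (set_poly (set_deriv j f) (y i)))).
  apply: ler_sum => j _; rewrite ler_wpM2l ?cabs_ge0 //; apply: nodes.
  exact: set_deriv_degree.
under eq_bigr do rewrite mulr_sumr.
rewrite exchange_big mulr_suml /=; apply: ler_sum => i Pi.
under eq_bigr do rewrite mulrCA.
by rewrite -mulr_sumr ler_wpM2l // grad.
Qed.

End LowDegreeSums.

Lemma sum_pair (V : nmodType) (I K : finType) (P : pred I) (F : I -> K -> V) :
  \sum_(i | P i) \sum_k F i k = \sum_(p : I * K | P p.1) F p.1 p.2.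
Proof. by rewrite pair_big_dep; apply: eq_bigl => p; rewrite andbT. Qed.

(** * Bounds for chi_mon and the projection constant from flat nodes *)

Section FlatNodes.
Variables (R : realType) (r : R) (s : \bar R) (d : R).
Hypotheses (r1 : 1 < r) (s1 : (1 <= s)%E) (d0 : 0 < d) (absd : absorbs r s d).
Local Notation C := R[i].
Local Notation ball z := (lorentz_norm r s z < 1).

Definition flat_point n (y : 'I_n -> C) := exists (B : {set 'I_n}) j,
  [/\ (0 < j)%N, (j <= n)%N, (#|B| <= j)%N,
      forall i, i \in B -> cabs (y i) <= d * j%:R `^ (- r^-1) &
      forall i, i \notin B -> y i = 0].

Lemma flat_point_absorbs n (y v z : 'I_n -> C) : flat_point y -> ball z ->
  (forall i, cabs (v i) <= cabs (y i) + d * cabs (z i)) -> ball v.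
Proof. by move=> [B [j [j0 jn Bj yB y0]]] zb; exact: (absd zb j0 jn Bj yB y0). Qed.

Lemma flat_point_ball n (y : 'I_n -> C) : flat_point y -> ball y.
Proof.
move=> fy; apply: (flat_point_absorbs fy (lorentz0_lt1 r1 s1 n)) => i.
by rewrite cabs0 mulr0 addr0.
Qed.

Lemma flat_point_sign_pt n m (A : {set 'I_n}) w : (0 < m)%N -> (m <= n)%N -> (#|A| <= m)%N ->
  flat_point (sign_pt (fun i => if i \in A then d * m%:R `^ (- r^-1) else 0) w).
Proof.
move=> m0 mn Am; exists A, m; split => // i iA.
  by rewrite cabs_sign_pt iA ger0_norm // mulr_ge0 ?powR_ge0 // ltW.
by rewrite /sign_pt (negPf iA) mul0r.
Qed.

Lemma flat_point_sign_pt_full n w : (0 < n)%N ->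
  flat_point (sign_pt (fun i : 'I_n => d * n%:R `^ (- r^-1)) w).
Proof.
move=> n0; exists [set: 'I_n]%SET, n; split; rewrite ?cardsT ?card_ord // => i.
  by move=> _; rewrite cabs_sign_pt ger0_norm // mulr_ge0 ?powR_ge0 // ltW.
by rewrite finset.in_setT.
Qed.

Variables (n m : nat) (J : {fset multi_index n}).
Hypotheses (m0 : (0 < m)%N) (mn : (m <= n)%N) (Jt : tetrahedral J) (Jm : deg_at_most J m).

(** The summand 1 pays for the constant coefficient, which is the value at 0. The factor 1/d comes
    from the gradient estimate in the direction d z, where [absorbs] keeps all points in the
    ball. *)
Lemma chi_mon_nodes (W : R) : 0 <= W ->
  (forall z : 'I_n -> C, ball z -> exists (I : finType) (P : pred I) (y : I -> 'I_n -> C) (mu : I -> R),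
    [/\ forall i, P i -> flat_point (y i), forall i, 0 <= mu i, \sum_(i | P i) mu i <= W &
     forall g : {set 'I_n} -> C, (forall A : {set 'I_n}, (m.-1 < #|A|)%N -> g A = 0) ->
     \sum_A cabs (g A) * \prod_(i in A) cabs (z i) <= \sum_(i | P i) mu i * cabs (set_poly g (y i))]) ->
  (chi_mon (lorentz_norm r s) J <= (1 + W / d)%:E)%E.
Proof.
move=> W0 H; apply: chi_mon_le => [|c z M zb PM].
  by rewrite ltr_wpDr // divr_ge0 // ltW.
have [I [P [y [mu [fy mu0 muW nodes]]]]] := H z zb.
pose f := set_coef c.
have M0 : 0 <= M by apply: le_trans (PM z zb); exact: cabs_ge0.
apply: (@le_trans _ _ (\sum_A cabs (f A) * \prod_(i in A) cabs (z i))).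
  apply: le_trans (sum_supp_le Jt _); last first.
    by move=> A; rewrite mulr_ge0 ?cabs_ge0 ?prodr_ge0 // => i _; exact: cabs_ge0.
  apply: ler_sum => a _; rewrite /f set_coef_supp // mon_supp // cabs_prod //.
apply: (@le_trans _ _ (cabs (f finset.set0) + (\sum_(i | P i) mu i) * (M / d))).
  apply: (abs_sum_le_nodes (m := m)) nodes _ => //; first exact: set_coef_degree.
  move=> i Pi; rewrite ler_pdivlMr // mulrC mulr_sumr.
  have := @set_poly_gradient R _ f (y i) (fun j => d%:C * z j) M.
  under eq_bigr do rewrite cabsM cabs_real gtr0_norm // -mulrA.
  apply=> x xy; rewrite -(poly_eval_set_poly Jt); apply: PM.
  apply: (flat_point_absorbs (fy i Pi) zb) => j.
  by have := xy j; rewrite cabsM cabs_real gtr0_norm.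
rewrite mulrDl mul1r lerD //.
  rewrite -set_poly0 -(poly_eval_set_poly Jt); apply: PM; exact: lorentz0_lt1.
by rewrite mulrAC -mulrA ler_wpM2r // divr_ge0 // ltW.
Qed.

(** Used when r <= 2. Summing over the signs cancels [cube_size], so the total weight of the nodes
    is the low-degree sum. *)
Lemma chi_mon_l1 (W : R) (x := d * m%:R `^ (- r^-1)) : 0 <= W ->
  (forall z : 'I_n -> C, ball z -> low_sum m.-1 (fun i => cabs (z i) / x) <= W) ->
  (chi_mon (lorentz_norm r s) J <= (1 + W / d)%:E)%E.
Proof.
have x0 : 0 < x by rewrite mulr_gt0 ?powR_gt0 ?ltr0n.
move=> W0 low; apply: chi_mon_nodes => // z zb.
have N0 := cube_size_gt0 R 'I_n.
exists ({set 'I_n} * {ffun 'I_n -> bool})%type, (fun p : {set 'I_n} * {ffun 'I_n -> bool} => #|p.1| <= m.-1)%N,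
  (fun p : {set 'I_n} * {ffun 'I_n -> bool} => sign_pt (fun i => if i \in p.1 then x else 0) p.2),
  (fun p : {set 'I_n} * {ffun 'I_n -> bool} => \prod_(i in p.1) (cabs (z i) / x) / cube_size R 'I_n); split.
- move=> [A w] /= Am; apply: flat_point_sign_pt => //.
  by apply: leq_trans Am _; exact: leq_pred.
- move=> [A w] /=; rewrite divr_ge0 ?(ltW N0) ?prodr_ge0 // => i _.
  by rewrite divr_ge0 ?cabs_ge0 // ltW.
- apply: le_trans (low z zb); rewrite /low_sum.
  have -> : \sum_(A : {set 'I_n} | (#|A| <= m.-1)%N) \prod_(i in A) (cabs (z i) / x) =
    \sum_(A : {set 'I_n} | (#|A| <= m.-1)%N) \sum_(w : {ffun 'I_n -> bool})
      \prod_(i in A) (cabs (z i) / x) / cube_size R 'I_n.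
    apply: eq_bigr => A _; rewrite sumr_const -mulr_natr -/(cube_size R 'I_n) divfK //.
    by rewrite gt_eqF.
  by rewrite sum_pair.
- move=> g gm; apply: le_trans (abs_sum_le_l1 z x0 gm) _.
  by rewrite sum_pair.
Qed.

(** Used when r > 2. The derivatives have degree m - 1, so Bonami's factor is 3^m. *)
Lemma chi_mon_l2 (W : R) (x := d * n%:R `^ (- r^-1)) : 0 <= W ->
  (forall z : 'I_n -> C, ball z ->
     3 ^+ m * Num.sqrt (low_sum m.-1 (fun i => (cabs (z i) / x) ^+ 2)) <= W) ->
  (chi_mon (lorentz_norm r s) J <= (1 + W / d)%:E)%E.
Proof.
have n0 : (0 < n)%N by exact: leq_trans mn.
have x0 : 0 < x by rewrite mulr_gt0 ?powR_gt0 ?ltr0n.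
move=> W0 low; apply: chi_mon_nodes => // z zb.
have N0 := cube_size_gt0 R 'I_n.
exists {ffun 'I_n -> bool}, xpredT, (sign_pt (fun=> x)),
  (fun=> 3 ^+ m * Num.sqrt (low_sum m.-1 (fun i => (cabs (z i) / x) ^+ 2)) / cube_size R 'I_n); split.
- by move=> w _; exact: flat_point_sign_pt_full.
- by move=> _; rewrite divr_ge0 ?mulr_ge0 ?exprn_ge0 ?sqrtr_ge0 // ltW.
- apply: le_trans (low z zb); rewrite sumr_const -[leLHS]mulr_natr -/(cube_size R 'I_n) divfK //.
  by rewrite gt_eqF.
- move=> g gm; have := abs_sum_le_l2 z x0 gm; by rewrite prednK.
Qed.

Lemma poly_eval_coef (c : J -> C) (b : 'I_n -> R) (a : J) :
  (\prod_(i in mi_supp (fsval a)) b i) != 0 ->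
  c a = \sum_w poly_eval c (sign_pt b w) *
    (walsh R (mi_supp (fsval a)) w / (cube_size R 'I_n * \prod_(i in mi_supp (fsval a)) b i)%:C).
Proof.
move=> b0; have N0 := cube_size_gt0 R 'I_n.
set S := mi_supp (fsval a); set K := cube_size R 'I_n * _.
have -> : \sum_w poly_eval c (sign_pt b w) * (walsh R S w / K%:C) =
    \sum_w walsh R S w * set_poly (set_coef c) (sign_pt b w) / K%:C.
  by apply: eq_bigr => w _; rewrite poly_eval_set_poly // mulrCA mulrA.
have K0 : K%:C != 0 :> C by rewrite fmorph_eq0 mulf_neq0 // gt_eqF.
rewrite -mulr_suml set_poly_coef set_coef_supp //.
by rewrite mulrCA -rmorphM -/K mulfK.
Qed.

(** Nodes are indexed by an element of [J] and a sign vector, and each contributes to the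
    coefficient of its own element only. Summed over the signs, the moduli at z give the product of
    |z_i| / x over the support. *)
Lemma proj_const_l1 (W : R) (x := d * m%:R `^ (- r^-1)) :
  (forall z : 'I_n -> C, ball z -> low_sum m (fun i => cabs (z i) / x) <= W) ->
  (proj_const (lorentz_norm r s) J <= W%:E)%E.
Proof.
have x0 : 0 < x by rewrite mulr_gt0 ?powR_gt0 ?ltr0n.
move=> low; have N0 := cube_size_gt0 R 'I_n.
have supm (a : J) : (#|mi_supp (fsval a)| <= m)%N by rewrite card_mi_supp //; exact/Jm/fsvalP.
pose b (a : J) i : R := if i \in mi_supp (fsval a) then x else 0.
have bx (a : J) : \prod_(i in mi_supp (fsval a)) b a i = \prod_(i in mi_supp (fsval a)) x.
  by apply: eq_bigr => i ia; rewrite /b ia.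
have b0 (a : J) : 0 < \prod_(i in mi_supp (fsval a)) b a i by rewrite bx prodr_gt0.
pose co (p : J * {ffun 'I_n -> bool}) : C :=
  walsh R (mi_supp (fsval p.1)) p.2 / (cube_size R 'I_n * \prod_(i in mi_supp (fsval p.1)) b p.1 i)%:C.
apply: (@proj_const_le R _ n J (J * {ffun 'I_n -> bool})%type
  (fun p => sign_pt (b p.1) p.2) (fun p a => if a == p.1 then co p else 0)).
- by move=> [a w] /=; apply: flat_point_ball; apply: flat_point_sign_pt.
- move=> c a; rewrite -(sum_pair xpredT (fun e w => poly_eval c (sign_pt (b e) w) *
     (if a == e then co (e, w) else 0))) /= (bigD1 a) //= [X in _ + X]big1 ?addr0.
    by rewrite eqxx; apply: poly_eval_coef; rewrite gt_eqF.
  by move=> e /negPf ea; apply: big1 => w _; rewrite eq_sym ea mulr0.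
- move=> z zb; apply: le_trans (low z zb).
  rewrite -(sum_pair xpredT (fun e w =>
    cabs (poly_eval (fun a => if a == e then co (e, w) else 0) z))) /=.
  pose h (A : {set 'I_n}) : R := if (#|A| <= m)%N then \prod_(i in A) (cabs (z i) / x) else 0.
  apply: (@le_trans _ _ (\sum_(a : J) h (mi_supp (fsval a)))); last first.
    rewrite /low_sum [leRHS]big_mkcond; apply: (sum_supp_le Jt (h := h)) => A; rewrite /h.
    by case: ifP => // _; apply: prodr_ge0 => i _; rewrite divr_ge0 ?cabs_ge0 // ltW.
  apply: ler_sum => e _; rewrite /h supm.
  have term w : cabs (poly_eval (fun a => if a == e then co (e, w) else 0) z) =
      \prod_(i in mi_supp (fsval e)) (cabs (z i) / x) / cube_size R 'I_n.
    rewrite /poly_eval (bigD1 e) //= eqxx big1 ?addr0 => [|a /negPf ->]; last by rewrite mul0r.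
    rewrite mon_supp // cabsM cabs_prod /co cabsM cabs_walsh mul1r cabsV cabs_real.
    rewrite ger0_norm; last by rewrite mulr_ge0 // ltW.
    rewrite big_split /= prodfV /= -bx invfM; ring.
  under eq_bigr do rewrite term.
  by rewrite sumr_const -mulr_natr -/(cube_size R 'I_n) divfK // gt_eqF.
Qed.

Lemma set_coef_sqr_sum_le (c : J -> C) (h : {set 'I_n} -> R) : (forall A, 0 <= h A) ->
  (forall a, cabs (c a) ^+ 2 <= h (mi_supp (fsval a))) ->
  \sum_A cabs (set_coef c A) ^+ 2 <= \sum_A h A.
Proof.
move=> h0 ch; apply: ler_sum => A _.
have [[a <-]|na] := pselect (exists a : J, mi_supp (fsval a) = A).
  by rewrite set_coef_supp.
rewrite /set_coef big1 ?cabs0 ?expr0n // => a /eqP aA.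
by case: na; exists a.
Qed.

(** For fixed z the interpolating polynomials form a Walsh sum in [w]. Cauchy-Schwarz in [w] and
    Parseval bound their moduli in total by the square root of the low-degree sum. *)
Lemma proj_const_l2 (W : R) (x := d * n%:R `^ (- r^-1)) :
  (forall z : 'I_n -> C, ball z ->
    Num.sqrt (low_sum m (fun i => (cabs (z i) / x) ^+ 2)) <= W) ->
  (proj_const (lorentz_norm r s) J <= W%:E)%E.
Proof.
have n0 : (0 < n)%N by exact: leq_trans mn.
have x0 : 0 < x by rewrite mulr_gt0 ?powR_gt0 ?ltr0n.
move=> low; have N0 := cube_size_gt0 R 'I_n.
have supm (a : J) : (#|mi_supp (fsval a)| <= m)%N by rewrite card_mi_supp //; exact/Jm/fsvalP.
have b0 (a : J) : 0 < \prod_(i in mi_supp (fsval a)) x by rewrite prodr_gt0.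
pose nu (a : J) : C := (cube_size R 'I_n * \prod_(i in mi_supp (fsval a)) x)%:C^-1.
apply: (@proj_const_le R _ n J {ffun 'I_n -> bool} (sign_pt (fun=> x))
  (fun w a => walsh R (mi_supp (fsval a)) w * nu a)).
- by move=> w; apply: flat_point_ball; exact: flat_point_sign_pt_full.
- by move=> c a; apply: (@poly_eval_coef c (fun=> x) a); rewrite gt_eqF.
- move=> z zb; apply: le_trans (low z zb).
  set L := low_sum _ _.
  have L0 : 0 <= L by apply: low_sum_ge0 => i; exact: sqr_ge0.
  pose c a := nu a * mon (fsval a) z.
  have F w : poly_eval (fun a => walsh R (mi_supp (fsval a)) w * nu a) z =
      walsh_sum [set: 'I_n]%SET (set_coef c) w.
    rewrite /walsh_sum; under [RHS]eq_bigl do rewrite finset.subsetT.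
    rewrite -[RHS]/(set_poly (set_coef c) (fun i => (-1) ^+ (w i))) -poly_eval_set_poly //.
    apply: eq_bigr => a _; rewrite /c !mon_supp //.
    by rewrite -/(walsh R (mi_supp (fsval a)) w) -mulrA mulrC.
  have Q : \sum_A cabs (set_coef c A) ^+ 2 <= L / cube_size R 'I_n ^+ 2.
    rewrite /L /low_sum [X in X / _]big_mkcond mulr_suml /=; apply: set_coef_sqr_sum_le.
      move=> A; rewrite divr_ge0 ?exprn_ge0 ?(ltW N0) //; case: ifP => // _.
      by apply: prodr_ge0 => i _; exact: sqr_ge0.
    move=> a; rewrite supm /c cabsM /nu cabsV cabs_real mon_supp // cabs_prod.
    rewrite ger0_norm; last by rewrite mulr_ge0 // ltW.
    set S := mi_supp (fsval a).
    have e : \prod_(i in S) (cabs (z i) / x) = (\prod_(i in S) cabs (z i)) / \prod_(i in S) x.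
      by rewrite big_split /= prodfV.
    have P0 : \prod_(i in S) x != 0 := lt0r_neq0 (b0 a).
    rewrite prodrXl e le_eqVlt; apply/orP; left; apply/eqP; field.
    by rewrite P0 gt_eqF.
  apply: (@le_trans _ _ (\sum_w cabs (poly_eval (fun a => walsh R (mi_supp (fsval a)) w * nu a) z) * 1)).
    by under [leRHS]eq_bigr do rewrite mulr1.
  have -> : Num.sqrt L = Num.sqrt (L / cube_size R 'I_n) * Num.sqrt (cube_size R 'I_n).
    by rewrite -sqrtrM ?divr_ge0 ?(ltW N0) // divfK // gt_eqF.
  apply: cauchy_schwarz_le; rewrite ?sqrtr_ge0 ?sqr_sqrtr ?divr_ge0 ?(ltW N0) //.
    under eq_bigr do rewrite F.
    rewrite walsh_parseval; under eq_bigl do rewrite finset.subsetT.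
    apply: le_trans (ler_wpM2l (ltW N0) Q) _.
    by rewrite le_eqVlt; apply/orP; left; apply/eqP; field; rewrite gt_eqF.
  under eq_bigr do rewrite expr1n.
  by rewrite sumr_const.
Qed.

End FlatNodes.

(** * Growth of the low-degree sums in n/m *)

Section Growth.
Variables (R : realType) (r : R) (s : \bar R) (d K : R).
Hypotheses (r1 : 1 < r) (d0 : 0 < d) (K0 : 0 < K).
Local Notation C := R[i].

(** Rankin's parameter is (n/m)^(1-1/r). The sum of |z_i| / x is at most (K/d) n^(1-1/r) m^(1/r) =
    (K/d) (n/m)^(1-1/r) m, so the exponential factor is at most exp(K/d)^m. *)
Lemma low_sum_l1_growth n m k (z : 'I_n -> C) : (0 < m)%N -> (m <= n)%N ->
  \sum_i cabs (z i) ^+ 1 <= K * n%:R `^ (1 - 1%:R / r) ->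
  low_sum k (fun i => cabs (z i) / (d * m%:R `^ (- r^-1))) <=
  ((n%:R / m%:R) `^ (1 - r^-1)) ^+ k * expR (K / d) ^+ m.
Proof.
move=> m0 mn; rewrite mul1r => zK; set x := d * _; set q := 1 - r^-1.
have m0' : (0 : R) < m%:R by rewrite ltr0n.
have x0 : 0 < x by rewrite mulr_gt0 ?powR_gt0.
have r0 : 0 < r by exact: lt_trans ltr01 r1.
have q0 : 0 <= q by rewrite subr_ge0 invf_le1 // ltW.
have rho1 : 1 <= n%:R / m%:R :> R by rewrite ler_pdivlMr // mul1r ler_nat.
set rho := n%:R / m%:R in rho1 *.
have sig1 : 1 <= rho `^ q by rewrite -[leLHS](powRr0 rho); exact: ler_powR.
apply: le_trans (low_sum_rankin k sig1 _) _ => [i|]; first by rewrite divr_ge0 ?cabs_ge0 // ltW.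
rewrite ler_wpM2l ?exprn_ge0 ?powR_ge0 // -expRM_natr ler_expR.
have sig0 : 0 < rho `^ q by exact: lt_le_trans ltr01 sig1.
rewrite ler_pdivrMr // -mulr_suml ler_pdivrMr //.
under eq_bigr do rewrite -[cabs _]expr1.
apply: le_trans zK _; rewrite -/q.
have -> : n%:R = rho * m%:R :> R by rewrite divfK // gt_eqF.
rewrite powRM ?ler0n //; last by apply: le_trans rho1.
have -> : m%:R `^ q = m%:R * m%:R `^ (- r^-1) :> R.
  by rewrite /q powRD ?powRr1 ?ler0n // (gt_eqF m0') implybT.
rewrite le_eqVlt; apply/orP; left; apply/eqP; rewrite /x; field.
by rewrite gt_eqF.
Qed.

(** Rankin's parameter is n/m, since the sum of (|z_i| / x)^2 is at most (K/d^2) n. The square root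
    halves the exponent of n/m; the exponential factor is kept as it is. *)
Lemma low_sum_l2_growth n m k (z : 'I_n -> C) : (0 < m)%N -> (m <= n)%N ->
  \sum_i cabs (z i) ^+ 2 <= K * n%:R `^ (1 - 2%:R / r) ->
  Num.sqrt (low_sum k (fun i => (cabs (z i) / (d * n%:R `^ (- r^-1))) ^+ 2)) <=
  ((n%:R / m%:R) `^ 2^-1) ^+ k * expR (K / d ^+ 2) ^+ m.
Proof.
move=> m0 mn zK; set x := d * _; set E := expR _.
have m0' : (0 : R) < m%:R by rewrite ltr0n.
have n0' : (0 : R) < n%:R by rewrite ltr0n (leq_trans m0).
have x0 : 0 < x by rewrite mulr_gt0 ?powR_gt0.
have rho1 : 1 <= n%:R / m%:R :> R by rewrite ler_pdivlMr // mul1r ler_nat.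
set rho := n%:R / m%:R in rho1 *.
have rho0 : 0 < rho by exact: lt_le_trans ltr01 rho1.
have E1 : 1 <= E by rewrite -expR0 ler_expR divr_ge0 ?exprn_ge0 // ltW.
have low : low_sum k (fun i => (cabs (z i) / x) ^+ 2) <= rho ^+ k * E ^+ m.
  apply: le_trans (low_sum_rankin k rho1 _) _ => [i|]; first exact: sqr_ge0.
  rewrite ler_wpM2l ?exprn_ge0 ?(ltW rho0) // -expRM_natr ler_expR.
  rewrite ler_pdivrMr //; under eq_bigr do rewrite expr_div_n.
  rewrite -mulr_suml ler_pdivrMr ?exprn_gt0 //; apply: le_trans zK _.
  have -> : n%:R `^ (1 - 2%:R / r) = n%:R * (n%:R `^ (- r^-1)) ^+ 2 :> R.
    rewrite -powR_mulrn ?powR_ge0 // -powRrM mulNr (mulrC r^-1).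
    by rewrite powRD ?powRr1 ?ler0n // (gt_eqF n0') implybT.
  have -> : n%:R = rho * m%:R :> R by rewrite divfK // gt_eqF.
  rewrite le_eqVlt; apply/orP; left; apply/eqP; rewrite /x.
  have -> : rho * m%:R = n%:R :> R by rewrite divfK // gt_eqF.
  by rewrite /rho; field; rewrite !gt_eqF.
rewrite -[leRHS](@ger0_norm _ _); last by rewrite mulr_ge0 ?exprn_ge0 ?powR_ge0 ?expR_ge0.
rewrite -sqrtr_sqr ler_wsqrtr //; apply: le_trans low _.
have -> : (rho `^ 2^-1 ^+ k * E ^+ m) ^+ 2 = rho ^+ k * (E ^+ m * E ^+ m).
  rewrite exprMn -!exprM mulnC exprM; congr (_ ^+ k * _); last by rewrite mulnC -exprD addnn mul2n.
  by rewrite powR12_sqrt ?sqr_sqrtr // ltW.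
rewrite ler_wpM2l ?exprn_ge0 ?(ltW rho0) // ler_peMr ?exprn_ege1 ?exprn_ge0 //.
exact: expR_ge0.
Qed.

Lemma absorb_constants (A S : R) m : (0 < m)%N -> 1 <= A -> 1 <= S ->
  1 + 3 ^+ m * (S * A ^+ m) / d <= ((1 + d^-1) * (3 * A)) ^+ m * S.
Proof.
move=> m0 A1 S1; set W := 3 ^+ m * (S * A ^+ m).
have dV0 : 0 < d^-1 by rewrite invr_gt0.
have D1 : 1 <= 1 + d^-1 by rewrite lerDl ltW.
have W1 : 1 <= W by rewrite !mulr_ege1 ?exprn_ege1 // ler1n.
have W0 : 0 <= W by exact: le_trans ler01 W1.
apply: (@le_trans _ _ ((1 + d^-1) ^+ 1 * W)).
  by rewrite expr1 mulrDl mul1r lerD // mulrC.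
have -> : ((1 + d^-1) * (3 * A)) ^+ m * S = (1 + d^-1) ^+ m * W.
  by rewrite /W !exprMn; ring.
by rewrite ler_wpM2r // ler_weXn2l.
Qed.

End Growth.


(** * The two regimes r <= 2 and r > 2 *)

Theorem theorem3p3 (R : realType) (r : R) (s : \bar R) :
  1 < r -> (1 <= s)%E ->
  exists C : R, 0 < C /\
    forall (m n : nat) (J : {fset multi_index n}),
      (1 <= m <= n)%N -> tetrahedral J -> deg_at_most J m ->
      (chi_mon (lorentz_norm r s) J
         <= (C ^+ m * (n%:R / m%:R) `^ ((m.-1)%:R * Num.min (2^-1) (1 - r^-1)))%:E)%E /\
      (proj_const (lorentz_norm r s) J
         <= (C ^+ m * (n%:R / m%:R) `^ (m%:R * Num.min (2^-1) (1 - r^-1)))%:E)%E.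
Proof.
move=> r1 s1.
have r0 : 0 < r by exact: lt_trans ltr01 r1.
have [d [d0 absd]] := lorentz_flat_perturbation r1 s1.
have powk (t : R) m n (k : nat) : (n%:R / m%:R : R) `^ (k%:R * t) = ((n%:R / m%:R) `^ t) ^+ k.
  by rewrite (mulrC k%:R) powRrM powR_mulrn ?powR_ge0.
set th := Num.min _ _.
have th0 : 0 <= th by rewrite le_min invr_ge0 ler0n subr_ge0 invf_le1 // ltW.
have rho1 m n : (0 < m)%N -> (m <= n)%N -> 1 <= (n%:R / m%:R : R) `^ th.
  move=> m0 mn; rewrite -[leLHS](powRr0 (n%:R / m%:R)); apply: ler_powR => //.
  by rewrite ler_pdivlMr ?ltr0n // mul1r ler_nat.
(* Both regimes are brought to a common form, from which C = (1 + 1/d) 3 A follows. The factor 3^m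
   stems from Bonami's inequality when r > 2 and is inserted in the other regime as well. *)
suff [A [A1 HA]] : exists A : R, 1 <= A /\
    forall (m n : nat) (J : {fset multi_index n}),
      (0 < m)%N -> (m <= n)%N -> tetrahedral J -> deg_at_most J m ->
      (chi_mon (lorentz_norm r s) J
         <= (1 + 3 ^+ m * (((n%:R / m%:R) `^ th) ^+ m.-1 * A ^+ m) / d)%:E)%E /\
      (proj_const (lorentz_norm r s) J
         <= (((n%:R / m%:R) `^ th) ^+ m * A ^+ m)%:E)%E.
  have D1 : 1 <= 1 + d^-1 by rewrite lerDl invr_ge0 ltW.
  have A0 : 0 <= A by exact: le_trans ler01 A1.
  have AC : A <= (1 + d^-1) * (3 * A).
    apply: (@le_trans _ _ (3 * A)); first by rewrite ler_peMl // ler1n.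
    by rewrite ler_peMl // mulr_ge0.
  exists ((1 + d^-1) * (3 * A)); split.
    by apply: lt_le_trans AC; exact: lt_le_trans ltr01 A1.
  move=> m n J /andP[m0 mn] Jt Jm; have [chi proj] := HA m n J m0 mn Jt Jm.
  have S1 k : 1 <= ((n%:R / m%:R : R) `^ th) ^+ k by rewrite exprn_ege1 // rho1.
  rewrite !powk; split.
    apply: le_trans chi _; rewrite lee_fin; exact: absorb_constants.
  apply: le_trans proj _; rewrite lee_fin [leLHS]mulrC ler_wpM2r ?(le_trans ler01 (S1 m)) //.
  by apply: lerXn2r; rewrite ?nnegrE // (le_trans A0).
(* The value r = 2 goes to the first regime, because the bound for the sum of squares requires 2 < r
   strictly. *)
have [r2|r2] := leP r 2.
  have [K [K0 HK]] := lorentz_power_sum (p := 1) r1 s1 isT r1.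
  have thE : th = 1 - r^-1.
    apply/min_idPr; rewrite lerBlDr -lerBlDl.
    have -> : 1 - 2^-1 = 2^-1 :> R by field.
    by rewrite lef_pV2 ?posrE.
  exists (expR (K / d)); split.
    by rewrite -expR0 ler_expR divr_ge0 // ltW.
  move=> m n J m0 mn Jt Jm; rewrite thE.
  have low k (z : 'I_n -> R[i]) zb := low_sum_l1_growth r1 d0 k m0 mn (HK n z zb).
  have low0 k : 0 <= ((n%:R / m%:R : R) `^ (1 - r^-1)) ^+ k * expR (K / d) ^+ m.
    by rewrite mulr_ge0 ?exprn_ge0 ?powR_ge0 ?expR_ge0.
  split; last by apply: (proj_const_l1 r1 s1 d0 absd m0 mn Jt Jm) => z; exact: low.
  apply: (chi_mon_l1 r1 s1 d0 absd m0 mn Jt Jm) => [|z zb]; first by rewrite mulr_ge0 ?exprn_ge0.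
  by apply: le_trans (low _ z zb) _; rewrite ler_peMl // exprn_ege1 // ler1n.
have [K [K0 HK]] := lorentz_power_sum (p := 2) r1 s1 isT r2.
have thE : th = 2^-1.
  apply/min_idPl; rewrite lerBrDr -lerBrDl.
  have -> : 1 - 2^-1 = 2^-1 :> R by field.
  by rewrite lef_pV2 ?posrE // ltW.
exists (expR (K / d ^+ 2)); split.
  by rewrite -expR0 ler_expR divr_ge0 ?exprn_ge0 // ltW.
move=> m n J m0 mn Jt Jm; rewrite thE.
have low k (z : 'I_n -> R[i]) zb := low_sum_l2_growth d0 K0 k m0 mn (HK n z zb).
have low0 k : 0 <= ((n%:R / m%:R : R) `^ 2^-1) ^+ k * expR (K / d ^+ 2) ^+ m.
  by rewrite mulr_ge0 ?exprn_ge0 ?powR_ge0 ?expR_ge0.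
split; last by apply: (proj_const_l2 r1 s1 d0 absd m0 mn Jt Jm) => z; exact: low.
apply: (chi_mon_l2 r1 s1 d0 absd m0 mn Jt Jm) => [|z zb]; first by rewrite mulr_ge0 ?exprn_ge0.
by rewrite ler_wpM2l ?exprn_ge0 // low.
Qed.
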